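(* Let $S$ be a finitely generated right cancellative semigroup that is hyperbolic (that is, the Cayley digraph of $S$ with respect to some finite generating set is hyperbolic). Then for every finite generating set $A$ of $S$, the Cayley digraph of $S$ with respect to $A$ is hyperbolic.
   Context: The (right) Cayley digraph of a semigroup $S$ with respect to a finite generating set $A$ has vertex set $S$ and edges from $x$ to $xa$ for all $x\in S$, $a\in A$. $S$ is right cancellative if $xa=ya$ implies $x=y$. Digraphs may have loops and multiple edges. For vertices $u,v$ let $d(u,v)$ be the length (number of edges) of a shortest directed path from $u$ to $v$, or $\infty$ if none exists. A digraph is regarded as a semimetric space as follows: the underlying set is the 1-complex of the underlying undirected multigraph, with each edge being a directed path of length 1; for points $x,y$ on a common edge with $y$ at or after $x$ on it, $d(x,y)$ is the length of the segment from $x$ to $y$; otherwise $d(x,y)=d(x,v)+d(v,w)+d(w,y)$, where $v$ is the head of the edge containing $x$ (or $v=x$ if $x$ is a vertex), $w$ is the tail of the edge containing $y$ (or $w=y$ if $y$ is a vertex), and $d(x,v)$, $d(w,y)$ are lengths of segments. A digraph is called hyperbolic if this semimetric space is hyperbolic in the following sense. A semimetric on a set $X$ is a map $d\colon X\times X\to[0,\infty]$ with $d(x,y)=0$ if and only if $x=y$, and satisfying the triangle inequality $d(x,y)\le d(x,z)+d(z,y)$ (no symmetry required). For $r\ge 0$ put $\mathcal B^+_r(x)=\{y: d(x,y)\le r\}$, $\mathcal B^-_r(x)=\{y: d(y,x)\le r\}$, and for $A\subseteq X$, $\mathcal B^{\pm}_r(A)=\bigcup_{a\in A}\mathcal B^{\pm}_r(a)$.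 The sets $\{y: d(x,y)<r\}$ generate the forward topology, and the sets $\{y:d(y,x)<r\}$ the backward topology. Equip a real interval $[a,b]$ with the semimetric $d(s,t)=t-s$ if $s\le t$ and $\infty$ if $s>t$. A directed path is a map $P\colon[a,b]\to X$ continuous for the forward topologies and also for the backward topologies, with starting point $P(a)$ and end point $P(b)$ (constant paths allowed). Its length is $\ell(P)=\lim_{N\to\infty}\sum_{i=1}^N d(P(t_{i-1}),P(t_i))$ with $t_i=a+i(b-a)/N$. An $x$-$y$ geodesic is a directed path $P$ from $x$ to $y$ with $d(P(s),P(t))=\ell(P|_{[s,t]})$ for all $s\le t$. A geodesic triangle consists of three (not necessarily distinct) points and three geodesics (the sides), one between every two of those points (in either direction). It is $\delta$-thin if, whenever $P,Q,R$ are its sides labelled so that the starting point of $P$ is the starting or end point of $Q$ and the end point of $P$ is the starting or end point of $R$, then (the image of) $P$ is contained in $\mathcal B^+_\delta(Q)\cup\mathcal B^-_\delta(R)$. The space is hyperbolic if there is $\delta\ge0$ such that all its geodesic triangles are $\delta$-thin. *)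

(* Defs.v *)
From HB Require Import structures.
From mathcomp Require Import all_boot all_order all_algebra.
From mathcomp Require Import all_classical all_reals all_analysis.
From mathcomp Require Import lra.

Set Implicit Arguments.
Unset Strict Implicit.
Unset Printing Implicit Defensive.

Import Order.TTheory GRing.Theory Num.Theory.
Import numFieldTopology.Exports.

Local Open Scope classical_set_scope.
Local Open Scope ring_scope.
Local Open Scope ereal_scope.

Record semimetric (R : realType) (X : Type) := Semimetric {
  dist :> X -> X -> \bar R;
  dist_ge0 : forall x y, 0 <= dist x y;
  dist_eq0 : forall x y, dist x y = 0 <-> x = y;
  dist_triangle : forall x y z, dist x z <= dist x y + dist y z }.

Section Balls.
Context {R : realType} {X : Type} (d : semimetric R X).

Definition out_ball (r : R) (x : X) : set X := [set y | d x y <= r%:E].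
Definition in_ball (r : R) (x : X) : set X := [set y | d y x <= r%:E].

Definition out_nbhd (r : R) (A : set X) : set X := \bigcup_(a in A) out_ball r a.
Definition in_nbhd (r : R) (A : set X) : set X := \bigcup_(a in A) in_ball r a.

Definition forward_balls : set (set X) :=
  [set U | exists x (r : R), U = [set y | d x y < r%:E]].
Definition backward_balls : set (set X) :=
  [set U | exists x (r : R), U = [set y | d y x < r%:E]].

End Balls.

(* Copies of X carrying the forward, resp. backward, topology of d. *)
Definition forward_space (R : realType) (X : Type) (d : semimetric R X) : Type := X.
Definition backward_space (R : realType) (X : Type) (d : semimetric R X) : Type := X.

Section Topologies.
Context {R : realType} {X : Type} (d : semimetric R X).

HB.instance Definition _ := gen_eqMixin (forward_space d).
HB.instance Definition _ := gen_choiceMixin (forward_space d).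
HB.instance Definition _ := @isSubBaseTopological.Build (forward_space d)
  (set X) (forward_balls d) id.

HB.instance Definition _ := gen_eqMixin (backward_space d).
HB.instance Definition _ := gen_choiceMixin (backward_space d).
HB.instance Definition _ := @isSubBaseTopological.Build (backward_space d)
  (set X) (backward_balls d) id.

End Topologies.

Section Interval.
Context {R : realType} (a b : R).

Definition interval_dist (s t : `[a, b]%classic) : \bar R :=
  if (val s <= val t)%R then (val t - val s)%:E else +oo.

Lemma interval_dist_ge0 s t : 0 <= interval_dist s t.
Proof. by rewrite /interval_dist; case: ifP => // st; rewrite lee_fin subr_ge0. Qed.

Lemma interval_dist_eq0 s t : interval_dist s t = 0 <-> s = t.
Proof.
rewrite /interval_dist; split=> [|->]; last by rewrite lexx subrr.
by case: ifP => // _ [] /eqP; rewrite subr_eq0 => /eqP /val_inj.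
Qed.

Lemma interval_dist_triangle s t u :
  interval_dist s u <= interval_dist s t + interval_dist t u.
Proof.
rewrite /interval_dist.
case: (leP (val s) (val t)) => st; case: (leP (val t) (val u)) => tu;
  rewrite ?addey ?addye ?leey //.
by rewrite (le_trans st tu) -EFinD lee_fin [leRHS]addrC subrKA.
Qed.

Definition interval_semimetric : semimetric R `[a, b]%classic :=
  Semimetric interval_dist_ge0 interval_dist_eq0 interval_dist_triangle.

End Interval.

(* A map [lo, hi] -> X is represented by a total function on R of which only
   the values on [lo, hi] are ever used. *)
Record curve (R : realType) (X : Type) := Curve {
  lo : R;
  hi : R;
  curve_fun :> R -> X }.

Section Paths.
Context {R : realType} {X : Type} (d : semimetric R X).
Implicit Types P Q : curve R X.

Definition start P : X := P (lo P).
Definition finish P : X := P (hi P).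
Definition image P : set X := P @` `[lo P, hi P]%classic.

Definition on_domain P (s : `[lo P, hi P]%classic) : X := P (val s).

Definition directed_path P : Prop :=
  [/\ (lo P <= hi P)%R,
      continuous (@on_domain P : forward_space (interval_semimetric (lo P) (hi P)) ->
                                 forward_space d) &
      continuous (@on_domain P : backward_space (interval_semimetric (lo P) (hi P)) ->
                                 backward_space d)].

Definition length_sum P (s t : R) (N : nat) : \bar R :=
  \sum_(i < N) d (P (s + i%:R * (t - s) / N%:R)%R)
                 (P (s + i.+1%:R * (t - s) / N%:R)%R).

(* The defining limit of the length of P restricted to [s, t] exists and is l. *)
Definition has_length P (s t : R) (l : \bar R) : Prop :=
  length_sum P s t n @[n --> \oo] --> l.

Definition geodesic P : Prop :=
  directed_path P /\
  forall s t : R, (lo P <= s)%R -> (s <= t)%R -> (t <= hi P)%R ->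
    has_length P s t (d (P s) (P t)).

Definition joins P (x y : X) : Prop :=
  (start P = x /\ finish P = y) \/ (start P = y /\ finish P = x).

(* Corners x 0, x 1, x 2; side i lies between corner i and the cyclically next
   corner, in either direction. *)
Definition geodesic_triangle (T : 'I_3 -> curve R X) : Prop :=
  exists x : 'I_3 -> X, forall i, geodesic (T i) /\ joins (T i) (x i) (x (ordS i)).

Definition endpoint P (x : X) : Prop := x = start P \/ x = finish P.

Definition thin (delta : R) (T : 'I_3 -> curve R X) : Prop :=
  forall p q r : 'I_3, uniq [:: p; q; r] ->
    endpoint (T q) (start (T p)) -> endpoint (T r) (finish (T p)) ->
    image (T p) `<=` out_nbhd d delta (image (T q)) `|` in_nbhd d delta (image (T r)).

Definition hyperbolic : Prop :=
  exists delta : R, (0 <= delta)%R /\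
    forall T, geodesic_triangle T -> thin delta T.

End Paths.

Record digraph := Digraph {
  vertex : Type;
  edge : Type;
  tail : edge -> vertex;
  head : edge -> vertex }.

Fixpoint walk (G : digraph) (n : nat) (u v : vertex G) : Prop :=
  if n is m.+1 then exists e : edge G, tail e = u /\ walk m (head e) v else u = v.

Definition vertex_dist (R : realType) (G : digraph) (u v : vertex G) : \bar R :=
  ereal_inf [set n%:R%:E | n in [set n | walk n u v]].

(* Points of the 1-complex; [Inner e t] is the interior point of e at distance t
   from the tail of e. *)
Inductive point (R : realType) (G : digraph) :=
| Vertex of vertex G
| Inner (e : edge G) (t : R) of (0 < t < 1)%R.

Section DigraphSpace.
Context {R : realType} {G : digraph}.
Implicit Types x y z : point R G.

Definition next_vertex x : vertex G :=
  match x with Vertex v => v | Inner e _ _ => head e end.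
Definition prev_vertex x : vertex G :=
  match x with Vertex v => v | Inner e _ _ => tail e end.
Definition to_next x : R :=
  match x with Vertex _ => 0%R | Inner _ t _ => (1 - t)%R end.
Definition from_prev x : R :=
  match x with Vertex _ => 0%R | Inner _ t _ => t end.

Definition through_dist x y : \bar R :=
  (to_next x)%:E + vertex_dist R (next_vertex x) (prev_vertex y) + (from_prev y)%:E.

(* When x or y is a vertex, the length of a segment from x to y on a common edge
   is also given by [through_dist], so only interior points need the first case
   (on a loop, the segment from its vertex to itself is the constant one). *)
Definition digraph_dist x y : \bar R :=
  match x, y with
  | Inner e s _, Inner f t _ =>
      if `[< e = f >] && (s <= t)%R then (t - s)%:E else through_dist x y
  | _, _ => through_dist x y
  end.

Lemma vertex_dist_ge0 (u v : vertex G) : 0 <= vertex_dist R u v.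
Proof. by apply: le_ereal_inf_tmp => _ [n _ <-]; rewrite lee_fin ler0n. Qed.

Lemma vertex_dist_le n (u v : vertex G) : walk n u v -> vertex_dist R u v <= n%:R%:E.
Proof. by move=> w; apply: ereal_inf_lbound; exists n. Qed.

Lemma vertex_distxx (v : vertex G) : vertex_dist R v v = 0.
Proof. by apply/le_anti; rewrite vertex_dist_ge0 (@vertex_dist_le 0). Qed.

Lemma vertex_dist_eq0 (u v : vertex G) : vertex_dist R u v = 0 -> u = v.
Proof.
move=> uv0; apply: contrapT => uv.
have : 1 <= vertex_dist R u v.
  by apply: le_ereal_inf_tmp => _ [[|n] w <-] //; rewrite lee_fin ler1n.
by rewrite uv0 lee_fin ler10.
Qed.

Lemma walk_cat m n (u v w : vertex G) : walk m u v -> walk n v w -> walk (m + n) u w.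
Proof.
elim: m u => [|m IH] u /=; first by move=> ->.
by move=> [e [eu ev]] vw; exists e; split=> //; apply: IH.
Qed.

Lemma vertex_distP (u v : vertex G) :
  (exists n, walk n u v /\ vertex_dist R u v = n%:R%:E) \/ vertex_dist R u v = +oo.
Proof.
have [ex|nex] := pselect (exists n, `[< walk n u v >]); last first.
  right; apply/eqP; rewrite -leye_eq; apply: le_ereal_inf_tmp => _ [n w <-].
  by case: nex; exists n; apply/asboolP.
left; exists (ex_minn ex); case: ex_minnP => n /asboolP w n_min; split=> //.
apply/le_anti/andP; split; first exact: vertex_dist_le.
by apply: le_ereal_inf_tmp => _ [m /asboolP/n_min mn <-]; rewrite lee_fin ler_nat.
Qed.

Lemma vertex_dist_triangle (u v w : vertex G) :
  vertex_dist R u w <= vertex_dist R u v + vertex_dist R v w.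
Proof.
have [[m [uv ->]]|->] := vertex_distP u v; last first.
  by case: vertex_dist (vertex_dist_ge0 v w) => // *; rewrite leey.
have [[n [vw ->]]|->] := vertex_distP v w; last by rewrite addey ?leey.
by rewrite -EFinD -natrD vertex_dist_le //; apply: walk_cat vw.
Qed.

Lemma edge_dist_le1 (e : edge G) : vertex_dist R (tail e) (head e) <= 1.
Proof. by apply: (@vertex_dist_le 1); exists e. Qed.

Lemma to_next_ge0 x : (0 <= to_next x)%R.
Proof. by case: x => //= e t /andP[_ /ltW]; rewrite subr_ge0. Qed.

Lemma from_prev_ge0 x : (0 <= from_prev x)%R.
Proof. by case: x => //= e t /andP[/ltW]. Qed.

Lemma through_dist_ge0 x y : 0 <= through_dist x y.
Proof.
by rewrite !adde_ge0 ?lee_fin ?to_next_ge0 ?from_prev_ge0 ?vertex_dist_ge0.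
Qed.

Lemma through_distP x y :
  (exists r : R, [/\ (0 <= r)%R, vertex_dist R (next_vertex x) (prev_vertex y) = r%:E &
     through_dist x y = (to_next x + r + from_prev y)%:E]) \/
  (vertex_dist R (next_vertex x) (prev_vertex y) = +oo /\ through_dist x y = +oo).
Proof.
rewrite /through_dist; have [[n [_ ->]]|->] := vertex_distP (next_vertex x) (prev_vertex y).
  by left; exists n%:R; split=> //; rewrite -?EFinD.
by right.
Qed.

Lemma same_edge_le (e f : edge G) (s t : R) : `[< e = f >] && (s <= t)%R -> e = f /\ (s <= t)%R.
Proof. by case/andP=> /asboolP. Qed.

Lemma digraph_dist_ge0 x y : 0 <= digraph_dist x y.
Proof.
case: x y => [u|e s hs] [v|f t ht] //=; rewrite ?through_dist_ge0 //.
by case: ifP => [/same_edge_le[_ st]|_]; rewrite ?through_dist_ge0 // lee_fin subr_ge0.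
Qed.

Lemma digraph_dist_le x y : digraph_dist x y <= through_dist x y.
Proof.
case: x y => [u|e s hs] [v|f t ht] //=.
case: ifP => // /same_edge_le[_ st].
have [[r [r0 _ ->]]|[_ ->]] := through_distP (Inner e hs) (Inner f ht); last exact: leey.
by rewrite lee_fin /=; lra.
Qed.

Lemma digraph_dist_eq0 x y : digraph_dist x y = 0 <-> x = y.
Proof.
split=> [|->]; last first.
  case: y => [v|e s hs] /=; last by rewrite lexx andbT asboolT // subrr.
  by rewrite /through_dist /= vertex_distxx !adde0.
have through0 : through_dist x y = 0 ->
    [/\ to_next x = 0%R, next_vertex x = prev_vertex y & from_prev y = 0%R].
  have [[r [r0 e ->]]|[_ ->//]] := through_distP x y.
  move=> [] eq0; have := to_next_ge0 x; have := from_prev_ge0 y => y0 x0.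
  split; [lra| |lra]; apply: vertex_dist_eq0; rewrite e; congr EFin; lra.
case: x y through0 => [u|e s hs] [v|f t ht] //= through0.
- by case/through0=> _ ->.
- by case/through0=> _ _ t0; exfalso; move: (ht) => /andP[]; rewrite t0 ltxx.
- by case/through0=> s1 _ _; exfalso; move: (hs) => /andP[_]; rewrite -subr_gt0 s1 ltxx.
- case: ifP => [/same_edge_le[ef st] []|_].
    move/eqP; rewrite subr_eq0 => /eqP ts.
    by clear through0; move: ht hs; rewrite ef ts => ht hs; congr Inner; apply: bool_irrelevance.
  by case/through0=> s1 _ _; exfalso; move: (hs) => /andP[_]; rewrite -subr_gt0 s1 ltxx.
Qed.

Lemma through_dist_triangle x y z :
  through_dist x z <= through_dist x y + through_dist y z.
Proof.
have xz := vertex_dist_triangle (next_vertex x) (prev_vertex y) (prev_vertex z).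
have yz := vertex_dist_triangle (prev_vertex y) (next_vertex y) (prev_vertex z).
have yy : vertex_dist R (prev_vertex y) (next_vertex y) <= (from_prev y + to_next y)%:E.
  case: y {xz yz} => [v|e t ht] /=; first by rewrite vertex_distxx addr0.
  by rewrite addrC subrK edge_dist_le1.
have := le_trans xz (leeD2l _ (le_trans yz (leeD2r _ yy))).
have [[r [r0 -> ->]]|[-> ->]] := through_distP x y; last first.
  by case: through_dist (through_dist_ge0 y z) => // *; rewrite leey.
have [[t [t0 -> ->]]|[-> ->]] := through_distP y z; last by rewrite addey ?leey.
have [[q [q0 -> ->]]|[-> ->]] := through_distP x z; rewrite -!EFinD ?leye_eq //.
by rewrite !lee_fin; lra.
Qed.

Lemma digraph_distP x y : digraph_dist x y = through_dist x y \/
  exists e s t (hs : (0 < s < 1)%R) (ht : (0 < t < 1)%R),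
    [/\ x = Inner e hs, y = Inner e ht, (s <= t)%R & digraph_dist x y = (t - s)%:E].
Proof.
case: x y => [u|e s hs] [v|f t ht] /=; try by left.
case: ifP => [/same_edge_le[ef st]|_]; [right|by left].
by move: ht; rewrite -ef => ht; exists e, s, t, hs, ht.
Qed.

Lemma digraph_dist_triangle x y z :
  digraph_dist x z <= digraph_dist x y + digraph_dist y z.
Proof.
have [->|[e [s [t [hs [ht [-> -> st ->]]]]]]] := digraph_distP x y.
  have [->|[e [s [t [hs [ht [-> -> st ->]]]]]]] := digraph_distP y z.
    exact: le_trans (digraph_dist_le _ _) (through_dist_triangle _ _ _).
  apply: le_trans (digraph_dist_le _ _) _.
  by rewrite /through_dist /= -[leRHS]addeA -EFinD [(s + _)%R]addrC subrK.
have [->|[f [t' [u [ht' [hu [[ef tt'] -> tu ->]]]]]]] := digraph_distP (Inner e ht) z.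
  apply: le_trans (digraph_dist_le _ _) _.
  by rewrite /through_dist /= !addeA -EFinD [(t - s + _)%R]addrC subrKA.
subst f t'; rewrite /= (le_trans st tu) asboolT //=.
by rewrite -EFinD lee_fin [leRHS]addrC subrKA.
Qed.

Definition digraph_semimetric : semimetric R (point R G) :=
  Semimetric digraph_dist_ge0 digraph_dist_eq0 digraph_dist_triangle.

End DigraphSpace.

Definition hyperbolic_digraph (R : realType) (G : digraph) : Prop :=
  hyperbolic (@digraph_semimetric R G).

Section Semigroups.
Context (S : semigroupType).

Definition right_cancellative : Prop :=
  forall a x y : S, (x * a)%g = (y * a)%g -> x = y.

Definition subsemigroup (B : set S) : Prop :=
  forall x y, B x -> B y -> B (x * y)%g.

Definition finite_generating_set (A : set S) : Prop :=
  finite_set A /\ smallest subsemigroup A = setT.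

Definition finitely_generated : Prop := exists A, finite_generating_set A.

Definition cayley_digraph (A : set S) : digraph :=
  {| vertex := S;
     edge := (S * A)%type;
     tail := fun e => e.1;
     head := fun e => (e.1 * val e.2)%g |}.

Definition hyperbolic_semigroup (R : realType) : Prop :=
  exists A, finite_generating_set A /\ hyperbolic_digraph R (cayley_digraph A).

End Semigroups.

(* Main.v *)
(** Fix a finite generating set for which the Cayley digraph G is hyperbolic and
    let H be another Cayley digraph. Both have the same vertices and their
    distances are linearly comparable, so a geodesic of H is a quasi-geodesic of
    G; it thus suffices that triangles of quasi-geodesics of G are thin.

    By right cancellativity all degrees of G are bounded. As a geodesic passes
    through distinct vertices, thinness of triangles then gives the following
    substitute for the symmetry of the metric: if u and v lie in a common
    out-ball (or in-ball) of radius r and v can be reached from u, then d(u,v) is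
    bounded in terms of r. Combining this with thinness, a geodesic with the ends
    of a path of N edges stays within O(log N) of that path, in both directions,
    and the usual argument turns this into stability of quasi-geodesics. Reversing
    all edges exchanges the two kinds of neighbourhoods, so that every statement
    is needed in one direction only. *)

Require Import Defs.
From mathcomp Require Import all_boot all_order all_algebra finmap.
From mathcomp Require Import all_classical all_reals all_analysis.
From mathcomp Require Import lra zify.
(* Again, so that [head] and [image] are not those of seq and fintype. *)
Require Import Defs.

Set Implicit Arguments.
Unset Strict Implicit.
Unset Printing Implicit Defensive.

Import Order.TTheory GRing.Theory Num.Theory.
Import numFieldTopology.Exports.

Local Open Scope classical_set_scope.

(** * Discrete geodesics *)

Section Reach.
Context {V : Type}.
Implicit Types (E : V -> V -> Prop) (u v w : V) (p q : nat -> V).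

(** No bound on d(x,y) follows from one on d(y,x), and a path from x to y need not exist at all.
    Hence every estimate first exhibits some path in the required direction, of whatever length, and
    only then invokes bounded divergence; lengths of geodesics running in opposite directions are
    compared through [linear_bound]. For the same reason being close to a set from it and being
    close to it are separate assertions, and the direction has to be tracked at each step. Constants
    depend on [d], [K] and [M] only and are fixed before the relation [E], so that a bound applies
    unchanged to the converse of [E]. The combinatorics lives on sequences of vertices: curves are
    turned into sequences at the end, and there the corners of a triangle may lie inside edges of H
    that are not edges of G. *)

Definition converse_rel E u v := E v u.

(** At most [n] edges, not exactly [n], so that bounds can be weakened freely. *)
Fixpoint reach E n u v : Prop :=
  if n is m.+1 then u = v \/ exists2 w, E u w & reach E m w v else u = v.

Lemma reachxx E n u : reach E n u u.
Proof. by case: n => [|n] //=; left. Qed.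

Lemma reach1 E u v : E u v -> reach E 1 u v.
Proof. by move=> uv; right; exists v. Qed.

Lemma reach_leq E m n u v : m <= n -> reach E m u v -> reach E n u v.
Proof.
elim: m n u => [|m IH] [|n] u //= mn; first by move->; left.
by case=> [->|[w uw wv]]; [left|right; exists w => //; exact: IH wv].
Qed.

Lemma reach_cat E m n u v w : reach E m u v -> reach E n v w -> reach E (m + n) u w.
Proof.
elim: m u => [|m IH] u /=; first by move->.
case=> [->|[x ux xv]] vw; last by right; exists x => //; exact: IH.
by apply: (@reach_leq E n (m + n).+1) vw; lia.
Qed.

Lemma reach_converse E n u v : reach (converse_rel E) n u v <-> reach E n v u.
Proof.
have half F m x y : reach (converse_rel F) m x y -> reach F m y x.
  elim: m x => [|m IH] x /=; first by move->.
  case=> [->|[w xw wy]]; first by left.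
  by have := reach_cat (IH _ wy) (@reach1 F _ _ xw); rewrite addn1.
by split; [exact: half|exact: (half (converse_rel E))].
Qed.

Definition geodesic_seq E x y n p :=
  [/\ p 0 = x, p n = y, forall i j, i <= j <= n -> reach E (j - i) (p i) (p j) &
      forall i j m, i <= j <= n -> reach E m (p i) (p j) -> j - i <= m].

Lemma geodesic_seq_exists E m x y : reach E m x y ->
  exists n p, n <= m /\ geodesic_seq E x y n p.
Proof.
move=> xy; have ex : exists n, `[< reach E n x y >] by exists m; apply/asboolP.
case: (ex_minnP ex) => n /asboolP xyn nmin.
have nmin' k : reach E k x y -> n <= k by move=> /asboolP /nmin.
have nm := nmin' _ xy.
have path_of k u v : reach E k u v -> exists p, [/\ p 0 = u, p k = v &
    forall i j, i <= j <= k -> reach E (j - i) (p i) (p j)].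
  elim: k u => [|k IH] u /=.
    move=> ->; exists (fun=> v); split=> // i j ij; exact: reachxx.
  have glue w : reach E 1 u w -> reach E k w v -> exists p, [/\ p 0 = u, p k.+1 = v &
    forall i j, i <= j <= k.+1 -> reach E (j - i) (p i) (p j)].
    move=> uw /IH[p [p0 pk pr]]; exists (fun i => if i is j.+1 then p j else u).
    split=> // -[|i] [|j] ij //.
      rewrite subn0 -add1n; apply: reach_cat uw _.
      by rewrite -p0 -{1}(subn0 j); apply: pr; lia.
    by rewrite subSS; apply: pr; lia.
  (* A shorter path is padded by repeating a vertex; for the minimal [n] chosen above this cannot
     occur. *)
  case=> [uv|[w uw wv]]; last exact: glue (reach1 uw) wv.
  by apply: (glue v); [left|exact: reachxx].
have [p [p0 pn pr]] := path_of _ _ _ xyn.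
exists n, p; split=> //; split=> // i j k ijn ij.
have x_i : reach E i x (p i) by rewrite -p0 -{1}(subn0 i); apply: pr; lia.
have j_y : reach E (n - j) (p j) y by rewrite -pn; apply: pr; lia.
by have := nmin' _ (reach_cat x_i (reach_cat ij j_y)); lia.
Qed.

Definition between E x y n p := geodesic_seq E x y n p \/ geodesic_seq E y x n p.

Lemma betweenC E x y n p : between E x y n p -> between E y x n p.
Proof. by case; [right|left]. Qed.

Lemma between_exists E m x y : reach E m x y \/ reach E m y x ->
  exists n p, n <= m /\ between E x y n p.
Proof.
by case=> /geodesic_seq_exists[n [p [nm pg]]]; exists n, p; split=> //; [left|right].
Qed.

Lemma geodesic_seq_reach E x y n p i j :
  geodesic_seq E x y n p -> i <= j <= n -> reach E (j - i) (p i) (p j).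
Proof. by case=> _ _ + _; apply. Qed.

Lemma geodesic_seq_leq E x y n p i j m :
  geodesic_seq E x y n p -> i <= j <= n -> reach E m (p i) (p j) -> j - i <= m.
Proof. by case=> _ _ _; apply. Qed.

Lemma geodesic_seq_sub E x y n p i j : geodesic_seq E x y n p -> i <= j <= n ->
  geodesic_seq E (p i) (p j) (j - i) (fun k => p (i + k)).
Proof.
move=> [_ _ pr pm] ij; split; rewrite ?addn0 // ?subnKC //; first by lia.
  move=> a b ab; rewrite (_ : b - a = i + b - (i + a)); last by lia.
  by apply: pr; lia.
move=> a b m ab /pm; lia.
Qed.

Lemma geodesic_seq_rev E x y n p : geodesic_seq E x y n p ->
  geodesic_seq (converse_rel E) y x n (fun k => p (n - k)).
Proof.
move=> [p0 pn pr pm]; split; rewrite ?subn0 ?subnn //.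
  move=> i j ij; apply/reach_converse; rewrite (_ : j - i = n - i - (n - j)); last by lia.
  by apply: pr; lia.
by move=> i j m ij /reach_converse /pm; lia.
Qed.

Lemma geodesic_seq_unrev E x y n p : geodesic_seq (converse_rel E) x y n p ->
  geodesic_seq E y x n (fun k => p (n - k)).
Proof. exact: geodesic_seq_rev. Qed.

Lemma between_rev E x y n p : between (converse_rel E) x y n p ->
  between E x y n (fun k => p (n - k)).
Proof. by case=> /geodesic_seq_unrev; [right|left]. Qed.

Lemma between_sub E x y n p j : between E x y n p -> j <= n ->
  exists m q, [/\ m <= n, between E x (p j) m q & 
    forall k, k <= m -> exists2 k', k' <= n & q k = p k'].
Proof.
move=> + jn; case=> pg.
  exists (j - 0), (fun k => p (0 + k)); split; first by lia.
    left; have p0 : p 0 = x by case: pg.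
    by rewrite -p0; apply: geodesic_seq_sub pg _; lia.
  by move=> k kj; exists (0 + k) => //; lia.
exists (n - j), (fun k => p (j + k)); split; first by lia.
  right; have pn : p n = x by case: pg.
  by rewrite -{1}pn; apply: geodesic_seq_sub pg _; lia.
by move=> k kj; exists (j + k) => //; lia.
Qed.

Definition thin_seqs E d := forall x y z n m l p q r,
  geodesic_seq E x y n p -> between E x z m q -> between E y z l r ->
  forall i, i <= n -> (exists2 j, j <= m & reach E d (q j) (p i)) \/
                      (exists2 j, j <= l & reach E d (p i) (r j)).

Definition bounded_divergence E (K : nat -> nat) := forall r m x u v,
  reach E r x u -> reach E r x v -> reach E m u v -> reach E (K r) u v.

(** Both divergence bounds are included to make the notion invariant under reversal of the edges. *)
Definition hyperbolic_rel E d K :=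
  [/\ thin_seqs E d, bounded_divergence E K & bounded_divergence (converse_rel E) K].

(** Reversal swaps the ends of [p], hence the roles of [q] and [r], and also the two kinds of
    neighbourhood; the two swaps cancel. *)
Lemma thin_seqs_converse E d : thin_seqs E d -> thin_seqs (converse_rel E) d.
Proof.
move=> thinE x y z n m l p q r pg qb rb i ni.
have := thinE _ _ _ _ _ _ _ _ _ (geodesic_seq_unrev pg) (between_rev rb) (between_rev qb) (n - i).
rewrite subKn // leq_subr => /(_ isT)[].
  by move=> [j jl /reach_converse pr]; right; exists (l - j) => //; exact: leq_subr.
by move=> [j jl /reach_converse pr]; left; exists (m - j) => //; exact: leq_subr.
Qed.

Lemma hyperbolic_rel_converse E d K :
  hyperbolic_rel E d K -> hyperbolic_rel (converse_rel E) d K.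
Proof. by case=> /thin_seqs_converse thinE outE inE; split. Qed.

End Reach.

(** * Thin triangles *)

Section Hyperbolic.
Context {V : Type} (E : V -> V -> Prop) (d : nat) (K : nat -> nat).
Hypothesis hypE : hyperbolic_rel E d K.
Implicit Types (u v w x y z : V) (p q r c : nat -> V).

Let thinE : thin_seqs E d. Proof. by case: hypE. Qed.
Let outE : bounded_divergence E K. Proof. by case: hypE. Qed.

Lemma in_divergence k m x u v :
  reach E k u x -> reach E k v x -> reach E m u v -> reach E (K k) u v.
Proof.
case: hypE => _ _ inE ux vx uv; apply/reach_converse.
by apply: (inE _ m x); apply/reach_converse.
Qed.

(* Thinness of the triangle with corners p i, y, r j. *)
Lemma stays_close x y z n l p r k i i' j :
  geodesic_seq E x y n p -> between E y z l r -> i <= i' <= n -> j <= l ->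
  reach E k (p i) (r j) -> exists2 j', j' <= l & reach E (k + d.*2 + 1) (p i') (r j').
Proof.
move=> pg rb ii' jl pr.
have [s [S [sk Sg]]] := geodesic_seq_exists pr.
have [l' [r' [l'l r'b r'r]]] := between_sub rb jl.
have pin : geodesic_seq E (p i) y (n - i) (fun k => p (i + k)).
  by have := @geodesic_seq_sub _ _ _ _ _ _ i n pg; case: (pg) => _ -> _ _; apply; lia.
have main h : i <= h <= n -> h - i <= k + d \/ exists2 j', j' <= l & reach E d (p h) (r j').
  move=> hn; have := thinE pin (or_introl Sg) r'b (_ : h - i <= n - i).
  rewrite subnKC; last by lia.
  case=> [|[a ak Sp]|[a al' pr']]; first by lia.
    left; have : reach E (a + d) (p i) (p h).
      apply: reach_cat Sp; rewrite -{1}(_ : S 0 = p i); last by case: Sg.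
      by rewrite -{1}(subn0 a); apply: geodesic_seq_reach Sg _; lia.
    by move/(geodesic_seq_leq pg) => /(_ hn); lia.
  by right; have [k' k'l e] := r'r _ al'; exists k' => //; rewrite -e.
have yr : exists2 j', j' <= l & r j' = p n.
  by case: pg => _ -> _ _; case: rb => -[r0 rl _ _]; [exists 0|exists l].
have [far|near] := ltnP (k + d) (i' - i).
  have [||[j' j'l e]] := main i'; [by lia|by move=> ?; lia|].
  by exists j' => //; apply: reach_leq e; lia.
have [short|long] := leqP n (i + k + d).
  have [j' j'l e] := yr; exists j' => //; rewrite e.
  by apply: (reach_leq _ (geodesic_seq_reach pg (_ : i' <= n <= n))); lia.
(* Near [p i] thinness may only give closeness to [S]; [p i'] therefore first moves along [p] to the
   first index where this is excluded. *)
have [||[j' j'l e]] := main (i + k + d).+1; [by lia|by move=> ?; lia|].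
exists j' => //; apply: reach_leq (reach_cat (geodesic_seq_reach pg _) e); lia.
Qed.

(* By thinness q lies in the out-neighbourhood of p until it gets close to r. The
   points of p used for consecutive points of q are a bounded distance apart, which
   puts p in the in-neighbourhood of q as well. *)
Definition fellow_const := K d.+1 + (d.*2).*2 + 2.

Lemma fellow_travel x y z n m l p q r :
  geodesic_seq E x y n p -> geodesic_seq E x z m q -> between E y z l r ->
  forall i, i <= n -> (exists2 j, j <= m & reach E fellow_const (p i) (q j)) \/
                      (exists2 j, j <= l & reach E fellow_const (p i) (r j)).
Proof.
move=> pg qg rb.
set concl := forall i, i <= n -> _.
(* Once [p g] is close to [r], [stays_close] deals with all later points of [p]. *)
have late k g : g <= n -> k <= d.*2.+1 ->
    (forall i, i <= g -> exists2 j, j <= m & reach E fellow_const (p i) (q j)) ->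
    (exists2 j, j <= l & reach E k (p g) (r j)) -> concl.
  move=> gn kd early [j jl pr] i ni; have [ig|gi] := leqP i g; first by left; apply: early.
  right; have [|j' j'l e] := stays_close pg rb (_ : g <= i <= n) jl pr; first by lia.
  by exists j' => //; apply: reach_leq e; rewrite /fellow_const; lia.
(* [g] is a frontier on [p]: all points up to it are already known to be close to [q]. *)
have step k : k <= m -> concl \/ exists g, [/\ g <= n, reach E d (p g) (q k) &
    forall i, i <= g -> exists2 j, j <= m & reach E fellow_const (p i) (q j)].
  elim: k => [|k IH] km.
    right; exists 0; have pq0 : p 0 = q 0 by case: pg qg => -> _ _ _ [-> _ _ _].
    split=> //; rewrite ?pq0; first exact: reachxx.
    by case=> // _; exists 0 => //; rewrite pq0; exact: reachxx.
  have [|/=|[g [gn pq early]]] := IH; [by lia|by left|].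
  have pqS : reach E d.+1 (p g) (q k.+1).
    rewrite -addn1; apply: reach_cat pq _; rewrite -{1}(subSnn k).
    by apply: geodesic_seq_reach qg _; lia.
  have [[g' g'n pq']|[j jl qr]] := thinE qg (or_introl pg) (betweenC rb) km.
    right; have [g'g|gg'] := leqP g' g.
      by exists g'; split=> // i ig'; apply: early; lia.
    exists g'; split=> // i ig'; have [ig|gi] := leqP i g; first exact: early.
    exists k.+1 => //.
    have pp : reach E (K d.+1) (p g) (p g').
      apply: in_divergence pqS _ (geodesic_seq_reach pg _); last by lia.
      by apply: reach_leq pq'.
    have gg := geodesic_seq_leq pg (_ : g <= g' <= n) pp.
    apply: reach_leq (reach_cat (geodesic_seq_reach pg (_ : i <= g' <= n)) pq'); last by lia.
    by rewrite /fellow_const; lia.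
  left; apply: (late d.*2.+1 g) => //; exists j => //.
  by apply: (reach_leq _ (reach_cat pqS qr)); lia.
have [//|[g [gn pq early]]] := step m (leqnn m).
apply: (late d g) => //; first by lia.
move: pq; case: qg => _ -> _ _ pq.
by case: rb => -[r0 rl _ _]; [exists l => //; rewrite rl|exists 0 => //; rewrite r0].
Qed.

(* Points of W far from b are close to T, and the points of W close to a given point
   of T are at most K d apart. *)
Definition linear_const k := K (k + d) + k + d + K d + 3.

Lemma linear_bound k a b v n t W T :
  reach E k a b \/ reach E k b a -> between E a v t T -> geodesic_seq E b v n W ->
  n <= linear_const k * t.+1.
Proof.
move=> ab Tb wg.
have [s [S [sk Sb]]] := between_exists ab.
set k1 := K (k + d) + k + d.
have far i : k1 < i <= n -> exists j : 'I_t.+1, reach E d (W i) (T j).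
  move=> /andP[k1i ni].
  have [[j js Sw]|[j jt wT]] := thinE wg (betweenC Sb) (betweenC Tb) ni; last first.
    by exists (Ordinal (jt : j < t.+1)).
  (* As [S] has at most [k] edges, a point of [W] close to it has index at most [k1], whichever way
     [S] runs. *)
  exfalso; have w0 : W 0 = b by case: wg.
  have : i - 0 <= k1.
    apply: (geodesic_seq_leq wg) => //; rewrite w0.
    have bw : reach E (i - 0) b (W i).
      by rewrite -w0; apply: geodesic_seq_reach wg _.
    case: Sb => Sg.
      have aw : reach E (j + d) a (W i).
        apply: reach_cat Sw; case: (Sg) => S0 _ _ _; rewrite -S0 -{1}(subn0 j).
        by apply: geodesic_seq_reach Sg _.
      have ab' : reach E s a b.
        case: (Sg) => S0 S1 _ _; rewrite -S0 -S1 -{1}(subn0 s).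
        by apply: geodesic_seq_reach Sg _; lia.
      apply: (@reach_leq _ _ (K (k + d))); first by rewrite /k1; lia.
      by apply: (@outE (k + d) _ a) bw; [apply: reach_leq ab'|apply: reach_leq aw]; lia.
    apply: (@reach_leq _ _ (j + d)); first by rewrite /k1; lia.
    apply: reach_cat Sw; case: (Sg) => S0 _ _ _; rewrite -S0 -{1}(subn0 j).
    by apply: geodesic_seq_reach Sg _.
  by lia.
rewrite leqNgt; apply/negP => big.
(* Pigeonhole: [t + 2] points of [W], spaced [K d + 1] apart, are assigned to the [t + 1] points of
   [T]. *)
pose idx (h : 'I_t.+2) := k1.+1 + h * (K d).+1.
have idxn h : k1 < idx h <= n.
  rewrite /idx; apply/andP; split; first by lia.
  have : h * (K d).+1 <= t.+1 * (K d).+1 by rewrite leq_mul2r; case: h => h /= ht; lia.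
  by move: big; rewrite /linear_const -/k1; nia.
have [g gP] := choice (fun h => far _ (idxn h)).
have ginj : injective g.
  have key h h' : g h = g h' -> h < h' -> False.
    move=> e hh'; have hw := gP h; have := gP h'; rewrite -e => h'w.
    have le : idx h + (K d).+1 <= idx h' by rewrite /idx; nia.
    have ih : idx h <= idx h' <= n by have := idxn h'; lia.
    have := in_divergence hw h'w (geodesic_seq_reach wg ih).
    by move=> /(geodesic_seq_leq wg ih); lia.
  move=> h h' e; apply: val_inj => /=.
  by case: (ltngtP h h') => // [/(key _ _ e)|/(key _ _ (esym e))].
by have := leq_card g ginj; rewrite !card_ord ltnn.
Qed.

Lemma chain_reach M N c i j : (forall i, i < N -> reach E M (c i) (c i.+1)) ->
  i <= j <= N -> reach E (M * (j - i)) (c i) (c j).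
Proof.
move=> cM; elim: j => [|j IH] ij; first by rewrite (_ : i = 0); [exact: reachxx|lia].
have [->|ij'] := eqVneq i j.+1; first exact: reachxx.
by rewrite subSn ?mulnS 1?addnC; [apply: reach_cat (IH _) (cM _ _)|]; lia.
Qed.

(** Bisection of the chain: each halving costs one [fellow_const]. Plain thinness would lead from
    [q] to [p] on the first half; [fellow_travel] starts at [p] in both cases, so the estimates
    compose. *)
Lemma log_close k : forall M N c n p, N <= 2 ^ k ->
  (forall i, i < N -> reach E M (c i) (c i.+1)) -> geodesic_seq E (c 0) (c N) n p ->
  forall i, i <= n -> exists2 j, j <= N & reach E (fellow_const * k + M) (p i) (c j).
Proof.
elim: k => [|k IH] M N c n p Nk cM pg i ni.
  exists N => //; rewrite muln0 add0n.
  have nM : n - 0 <= M.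
    apply: (geodesic_seq_leq pg); first by lia.
    case: pg => -> -> _ _; move: Nk cM; rewrite expn0; case: N {ni} => [|[|]] // _ cM.
      exact: reachxx.
    exact: cM.
  case: (pg) => _ <- _ _; apply: (@reach_leq _ _ (n - i)); first by lia.
  by apply: geodesic_seq_reach pg _; lia.
pose h := N./2.
have hN : h <= N by rewrite /h; lia.
have [h1 h2] : h <= 2 ^ k /\ N - h <= 2 ^ k by move: Nk; rewrite /h expnS; lia.
have r1 := @chain_reach M N c 0 h cM; have r2 := @chain_reach M N c h N cM.
have [m [q [_ qg]]] := geodesic_seq_exists (r1 (hN : 0 <= h <= N)).
have [|l [r [_ rg]]] := geodesic_seq_exists (r2 _); first by lia.
have := fellow_travel pg qg (or_intror rg) ni.
case=> -[j jm pj].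
  have [|a ah qa] := IH M h c m q h1 _ qg j jm; first by move=> a ah; apply: cM; lia.
  exists a; first by lia.
  by apply: (reach_leq _ (reach_cat pj qa)); rewrite mulnS; lia.
have [||a ah ra] := IH M (N - h) (fun a => c (h + a)) l r h2 _ _ j jm.
- by move=> a ah; rewrite addnS; apply: cM; lia.
- by rewrite addn0 subnKC.
exists (h + a); first by lia.
by apply: (reach_leq _ (reach_cat pj ra)); rewrite mulnS; lia.
Qed.

End Hyperbolic.

(** * Stability of quasi-geodesics *)

Lemma leq_sqr_exp2 k : k.+1 ^ 2 <= 4 * 2 ^ k.
Proof.
have [|k4] := leqP k 4; first by case: k => [|[|[|[|[|]]]]].
rewrite -(subnK k4); elim: (k - 5) => [//|m IH].
by move: IH; rewrite addSn (expnS 2) -!mulnn; nia.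
Qed.

(** [k] is taken as large as the second inequality allows, about [D / (a + 1)]; a quadratic lower
    bound for [2 ^ k] then gives the first. *)
Lemma log_sublinear A B a : exists D0, forall D, D0 <= D ->
  exists k, B * D.+1 <= 2 ^ k /\ A + a * k < D.
Proof.
pose b := B * (a + A + 3); exists ((a.+1) * (4 * b) + A + 1) => D DD.
exists ((D - A - 1) %/ a.+1); set k := _ %/ _.
have k1 : k * a.+1 <= D - A - 1 by exact: leq_trunc_div.
have k2 : D - A - 1 < k.+1 * a.+1 by exact: ltn_ceil.
have DA : A + 1 <= D by lia.
split; last first.
  have ak : a * k <= k * a.+1 by nia.
  by lia.
have bk : 4 * b <= k by rewrite /k leq_divRL //; lia.
have : 4 * (B * D.+1) <= k.+1 ^ 2.
  have DD' : D.+1 <= (a + A + 3) * k.+1 by nia.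
  by rewrite -mulnn; apply: (@leq_trans (4 * b * k.+1)); rewrite /b; nia.
by have := leq_sqr_exp2 k; lia.
Qed.

Section Stability.
Context {V : Type}.
Implicit Types (E : V -> V -> Prop) (c p : nat -> V).

(** The lower bound concerns paths along the direction of [c] only; the [k.+1] absorbs an additive
    constant. *)
Definition quasi_geodesic_seq E M N c :=
  (forall i, i < N -> reach E M (c i) (c i.+1)) /\
  (forall i j k, i <= j <= N -> reach E k (c i) (c j) -> j - i <= M * k.+1).

Lemma quasi_geodesic_seq_rev E M N c : quasi_geodesic_seq E M N c ->
  quasi_geodesic_seq (converse_rel E) M N (fun i => c (N - i)).
Proof.
move=> [step long]; split=> [i iN|i j k ij /reach_converse ck].
  apply/reach_converse; rewrite (_ : N - i = (N - i.+1).+1); last by lia.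
  by apply: step; lia.
by have := long (N - j) (N - i) k; move=> /(_ _ ck); lia.
Qed.

Section Improve.
Context (E : V -> V -> Prop) (d : nat) (K : nat -> nat) (M : nat).
Hypothesis hypE : hyperbolic_rel E d K.
Let a := fellow_const d K.
(** [after] and [before] are one more than the factors that the two contradictions in
    [stability_step] need: a divergence bound and a linear comparison of geodesics. *)
Let after := K a.+1 + 1.
Let before := (linear_const d K (K (a + d))).+1.
Let thinE : thin_seqs E d. Proof. by case: hypE. Qed.
(** [slack * D.+1] bounds the number of edges of the piece of [c] that is bisected. *)
Let slack := M * ((linear_const d K 0).+1 * (before + after + 4) + 1).

(* For large D the bound obtained is less than D, as k may be chosen logarithmic in D.
   The point p i is cut off by p b and p e, where p e comes a constant number of steps
   later and p b a number of steps earlier that is linear in D. *)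
Lemma stability_step N c n p D k :
  quasi_geodesic_seq E M N c -> geodesic_seq E (c 0) (c N) n p ->
  (forall i, i <= n -> (exists2 j, j <= N & reach E D (p i) (c j)) /\
                       (exists2 j, j <= N & reach E D (c j) (p i))) ->
  slack * D.+1 <= 2 ^ k ->
  forall i, i <= n -> exists2 j, j <= N &
    reach E (maxn (after + a + d + d.*2 + 1 + M + a * k) D.-1) (p i) (c j).
Proof.
move=> [step long] pg near kbig i ni.
set r := maxn _ _.
have pgr := geodesic_seq_reach pg.
have pN : p n = c N by case: pg.
have p0 : p 0 = c 0 by case: pg.
have [short|far] := leqP n (i + after).
  exists N => //; rewrite -pN; apply: reach_leq (pgr _ _ (_ : i <= n <= n)); last by lia.
  by rewrite /r; lia.
set e := i + after.
have en : e <= n by rewrite /e; lia.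
have [[t tN pct] _] := near e en.
have [l [Sp [lD Spg]]] := geodesic_seq_exists pct.
(* Closeness to a geodesic between two points of [c] suffices if its length is linear in [D]: the
   piece of [c] between them is then short enough for [log_close]. *)
have close_T s T tl : s <= N -> geodesic_seq E (c s) (c t) tl T ->
    tl.+1 <= (before + after + 4) * D.+1 ->
    (exists2 j, j <= tl & reach E (a + d) (p i) (T j)) ->
    exists2 j, j <= N & reach E r (p i) (c j).
  move=> sN Tg tlD [j jtl pT].
  have ctT : reach E tl (c s) (c t).
    case: (Tg) => <- <- _ _; rewrite -{1}(subn0 tl).
    by apply: geodesic_seq_reach Tg _; lia.
  have [st|ts] := leqP s t.
    have [|||j' j't Tc] :=
      @log_close _ _ _ _ hypE k M (t - s) (fun h => c (s + h)) tl T _ _ _ j jtl.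
    - have := @long s t tl _ ctT; rewrite st tN => /(_ isT) ts.
      apply: leq_trans ts (leq_trans _ kbig).
      rewrite /slack -mulnA leq_mul2l; apply/orP; right.
      by apply: leq_trans tlD _; rewrite leq_mul2r mulSn; apply/orP; right; lia.
    - by move=> h hts; rewrite addnS; apply: step; lia.
    - by rewrite addn0 subnKC.
    exists (s + j'); first by lia.
    by apply: reach_leq (reach_cat pT Tc); rewrite /r -/a; lia.
  (* [T] runs against [c]. It is replaced by a geodesic [U] along [c], of comparable length by
     [linear_bound]; [stays_close], started at the common corner [c s], leads from [T] to [U]. *)
  have ctcs : reach E (M * (s - t)) (c t) (c s).
    by apply: (chain_reach step); lia.
  have [v [U [_ Ug]]] := geodesic_seq_exists ctcs.
  have vtl : v <= linear_const d K 0 * tl.+1.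
    by apply: (linear_bound hypE _ (or_intror Tg) Ug); left; exact: reachxx.
  have TU0 : reach E 0 (T 0) (U v) by case: Tg Ug => -> _ _ _ [_ -> _ _].
  have [//|j1 j1v TU] :=
    stays_close hypE Tg (or_introl Ug) (_ : 0 <= j <= tl) (leqnn v) TU0.
  have ctcs' : reach E v (c t) (c s).
    case: (Ug) => <- <- _ _; rewrite -{1}(subn0 v).
    by apply: geodesic_seq_reach Ug _; lia.
  have [|||j' j't Uc] :=
    @log_close _ _ _ _ hypE k M (s - t) (fun h => c (t + h)) v U _ _ _ j1 j1v.
  - have := @long t s v _ ctcs'; rewrite (ltnW ts) sN => /(_ isT) st.
    apply: leq_trans st (leq_trans _ kbig).
    rewrite /slack -mulnA leq_mul2l; apply/orP; right.
    move: vtl tlD; set C := linear_const d K 0; set X := before + after + 4 => vtl tlD.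
    have : C * tl.+1 <= C * (X * D.+1) by rewrite leq_mul2l tlD orbT.
    by rewrite mulnDl mul1n mulSn mulnDl -mulnA; lia.
  - by move=> h hts; rewrite addnS; apply: step; lia.
  - by rewrite addn0 subnKC // ltnW.
  exists (t + j'); first by lia.
  by apply: reach_leq (reach_cat (reach_cat pT TU) Uc); rewrite /r -/a; lia.
set b := i - before * D.+1.
have bi : b <= i by rewrite /b; lia.
have pbt : reach E (e - b + D) (p b) (c t).
  by apply: reach_cat pct; apply: pgr; lia.
have [ul [U [uD Ug]]] := geodesic_seq_exists pbt.
have peg : geodesic_seq E (p b) (p e) (e - b) (fun h => p (b + h)).
  by apply: geodesic_seq_sub pg _; lia.
have [|[j ju pU]|[j jl pS]] := fellow_travel hypE peg Ug (or_introl Spg) (_ : i - b <= e - b).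
- by lia.
- rewrite -/a subnKC // in pU.
  (* By truncated subtraction [b = 0] in the first case, and [U] starts at [c 0] itself. *)
  have [near_start|i_large] := ltnP i (before * D.+1).
    have b0 : b = 0 by rewrite /b; lia.
    apply: (close_T 0 U ul) => //; first by rewrite -p0 -b0.
      apply: (@leq_trans (e - b + D).+1) => //.
      by rewrite /e !mulnDl; have := leq_pmulr after (ltn0Sn D); lia.
    by exists j => //; apply: reach_leq pU; lia.
  have [_ [s sN csp]] := near b (leq_trans bi ni).
  have [m [Sm [mD Smg]]] := geodesic_seq_exists csp.
  have csct : reach E (D + (e - b + D)) (c s) (c t) by apply: reach_cat csp pbt.
  have [tl [T [tlD Tg]]] := geodesic_seq_exists csct.
  have [[j1 j1m SU]|[j1 j1t UT]] := thinE Ug (or_intror Smg) (or_intror Tg) ju; last first.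
    apply: (close_T s T tl) => //; last by exists j1 => //; apply: reach_cat pU UT.
    apply: (@leq_trans (D + (e - b + D)).+1) => //.
    by rewrite /e /b !mulnDl; have := leq_pmulr after (ltn0Sn D); lia.
  (* [Sm j1] would be boundedly close to [p i], so [i - b] would be bounded linearly by the rest of
     [Sm], which has at most [D] edges; [before] rules this out. The converse relation is used
     because the common corner [p b] is the start of the long geodesic. *)
  exfalso.
  have Sm_end : Sm m = p b by case: Smg.
  have Spi : reach E (m - j1 + (i - b)) (Sm j1) (p i).
    apply: reach_cat (pgr _ _ _); last by lia.
    by rewrite -Sm_end; apply: geodesic_seq_reach Smg _; lia.
  have near_S : reach E (K (a + d)) (Sm j1) (p i).
    by apply: (in_divergence hypE) Spi; [apply: reach_leq SU|apply: reach_leq pU]; lia.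
  have Sg : geodesic_seq E (Sm j1) (p b) (m - j1) (fun h => Sm (j1 + h)).
    by rewrite -Sm_end; apply: geodesic_seq_sub Smg _; lia.
  have pbi : geodesic_seq E (p b) (p i) (i - b) (fun h => p (b + h)).
    have := @geodesic_seq_sub _ _ _ _ _ _ b i pg; apply; lia.
  have := linear_bound (hyperbolic_rel_converse hypE)
    (or_intror ((reach_converse _ _ _ _).2 near_S))
    (or_intror (geodesic_seq_rev Sg)) (geodesic_seq_rev pbi).
  have : linear_const d K (K (a + d)) * (m - j1).+1 < before * D.+1.
    apply: (@leq_trans (linear_const d K (K (a + d)) * D.+1).+1).
      by rewrite ltnS leq_mul2l; apply/orP; right; lia.
    by rewrite /before mulSn; lia.
  by rewrite /b; lia.
- exists t => //; rewrite -/a subnKC // in pS.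
  have Sp0 : Sp 0 = p e by case: Spg.
  have Spl : Sp l = c t by case: Spg.
  (* For small [j], [p e] would be nearer to [p i] than [after] steps. For large [j], going from
     [p i] through [Sp j] to [c t] takes at most [a + D - (a + 2)] steps: this is where [D]
     drops. *)
  have [j_small|j_large] := leqP j a.+1.
    have pe : reach E (K a.+1) (p i) (p e).
      apply: (in_divergence hypE) (pgr i e _); last by lia.
        by apply: reach_leq pS.
      rewrite -Sp0; apply: reach_leq j_small _; rewrite -{1}(subn0 j).
      exact: geodesic_seq_reach Spg _.
    have := geodesic_seq_leq pg (_ : i <= e <= n) pe.
    by rewrite /e /after; lia.
  have : reach E (a + (l - j)) (p i) (c t).
    rewrite -Spl; apply: reach_cat pS _; apply: geodesic_seq_reach Spg _; lia.
  by apply: reach_leq; rewrite /r; lia.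
Qed.

End Improve.

(** The least [D] that works in both directions cannot exceed [D0]: [stability_step], for [E] and
    for its converse, would improve both directions to [D - 1]. *)
Lemma morse_seq d K M : exists D0, forall E, hyperbolic_rel E d K ->
  forall N c n p, quasi_geodesic_seq E M N c -> geodesic_seq E (c 0) (c N) n p ->
  forall i, i <= n -> (exists2 j, j <= N & reach E D0 (p i) (c j)) /\
                      (exists2 j, j <= N & reach E D0 (c j) (p i)).
Proof.
set a := fellow_const d K.
set after := K a.+1 + 1.
set slack := M * ((linear_const d K 0).+1 *
  ((linear_const d K (K (a + d))).+1 + after + 4) + 1).
set A := after + a + d + d.*2 + 1 + M.
have [D0 D0P] := log_sublinear A.+1 slack a.
exists D0 => E hypE N c n p cq pg.
pose near D := forall i, i <= n -> (exists2 j, j <= N & reach E D (p i) (c j)) /\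
                                   (exists2 j, j <= N & reach E D (c j) (p i)).
have pN : p n = c N by case: pg.
have p0 : p 0 = c 0 by case: pg.
have ex : exists D, `[< near D >].
  exists n; apply/asboolP => i ni; split; [exists N|exists 0] => //; rewrite -?pN -?p0.
    apply: (@reach_leq _ _ (n - i)); first by lia.
    by apply: geodesic_seq_reach pg _; lia.
  apply: (@reach_leq _ _ (i - 0)); first by lia.
  by apply: geodesic_seq_reach pg _; lia.
case: (ex_minnP ex) => D /asboolP nearD Dmin.
have [DD0|D0D] := leqP D D0.
  by move=> i /nearD[[j jN pc] [j' j'N cp]]; split; [exists j|exists j'] => //;
    [apply: reach_leq pc|apply: reach_leq cp].
have [k [kD kA]] := D0P D (ltnW D0D).
have small : maxn (A + a * k) D.-1 <= D.-1 by lia.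
have : D <= D.-1; last by lia.
apply: Dmin; apply/asboolP => i ni; split.
  have [j jN pc] := stability_step hypE cq pg nearD kD ni.
  by exists j => //; apply: reach_leq pc.
have pg' : geodesic_seq (converse_rel E) (c (N - 0)) (c (N - N)) n (fun i => p (n - i)).
  by rewrite subn0 subnn; apply: geodesic_seq_rev.
have [|j jN] := stability_step (hyperbolic_rel_converse hypE)
  (quasi_geodesic_seq_rev cq) pg' _ kD (leq_subr i n).
  move=> h hn; have [[j jN pc] [j' j'N cp]] := nearD (n - h) (leq_subr _ _).
  split; [exists (N - j')|exists (N - j)]; rewrite ?leq_subr ?subKn //.
    exact/reach_converse.
  exact/reach_converse.
rewrite subKn // => /reach_converse cp.
by exists (N - j); [exact: leq_subr|apply: reach_leq cp].
Qed.

End Stability.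

(** * Thin triangles of quasi-geodesics, and bounded divergence from bounded degree *)

Section Triangles.
Context {V : Type}.
Implicit Types (E : V -> V -> Prop) (x y z : V) (c p : nat -> V).

(** While [p] is traversed, the index of a nearby point of [c] must pass [i]. The points of [c]
    before and after the passage lie in one out-ball around a point of [p], so the jump over [i] is
    bounded. *)
Lemma quasi_near_geodesic_out d K M : exists D1, forall E, hyperbolic_rel E d K ->
  forall N c n p, quasi_geodesic_seq E M N c -> geodesic_seq E (c 0) (c N) n p ->
  forall i, i <= N -> exists2 j, j <= n & reach E D1 (p j) (c i).
Proof.
have [D0 D0P] := @morse_seq V d K M.
exists (D0 + M * (M * (K D0 + K D0.+1 + 1))) => E hypE N c n p cq pg i iN.
have near := D0P E hypE N c n p cq pg.
have [_ outE _] := hypE; have [step long] := cq.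
have pN : p n = c N by case: pg.
have p0 : p 0 = c 0 by case: pg.
set goal := exists2 j, _ & _.
have jump k t t' B : k <= n -> t <= i <= t' -> t' <= N -> reach E D0 (p k) (c t) ->
    reach E B (c t) (c t') -> B <= K D0 + K D0.+1 -> goal.
  move=> kn /andP[ti it'] t'N pc cc Bk; exists k => //.
  have tt' := long _ _ _ (_ : t <= t' <= N) cc.
  have ct : reach E (M * (i - t)) (c t) (c i) by apply: (chain_reach step); lia.
  apply: reach_leq (reach_cat pc ct); rewrite leq_add2l leq_mul2l; apply/orP; right.
  apply: (@leq_trans (t' - t)); first by lia.
  apply: leq_trans (tt' _) _; first by lia.
  by rewrite leq_mul2l; apply/orP; right; lia.
have walk k : k <= n -> goal \/ exists2 t, t <= i & reach E D0 (p k) (c t).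
  elim: k => [|k IH] kn.
    by right; exists 0 => //; rewrite p0; exact: reachxx.
  have [|//|[t ti pc]] := IH; [by lia|by left|].
  have [[t' t'N pc'] _] := near k.+1 kn.
  have [t'i|it'] := leqP t' i; first by right; exists t'.
  left; apply: (jump k t t' (K D0.+1)) => //; [by lia|by lia| |by lia].
  have pk : reach E D0.+1 (p k) (c t').
    rewrite -add1n; apply: reach_cat pc'; rewrite -(subSnn k).
    by apply: geodesic_seq_reach pg _; lia.
  have ct : reach E (M * (t' - t)) (c t) (c t') by apply: (chain_reach step); lia.
  by apply: outE ct; [apply: reach_leq pc|exact: pk].
have [//|[t ti pc]] := walk n (leqnn n).
apply: (jump n t N (K D0)) => //; [by lia| |by lia].
have ct : reach E (M * (N - t)) (c t) (c N) by apply: (chain_reach step); lia.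
by apply: outE ct; [exact: pc|rewrite pN; exact: reachxx].
Qed.

Lemma quasi_near_geodesic d K M : exists D1, forall E, hyperbolic_rel E d K ->
  forall N c n p, quasi_geodesic_seq E M N c -> geodesic_seq E (c 0) (c N) n p ->
  forall i, i <= N -> (exists2 j, j <= n & reach E D1 (p j) (c i)) /\
                      (exists2 j, j <= n & reach E D1 (c i) (p j)).
Proof.
have [D1 D1P] := quasi_near_geodesic_out d K M.
exists D1 => E hypE N c n p cq pg i iN; split; first exact: (D1P E) iN.
have pg' : geodesic_seq (converse_rel E) (c (N - 0)) (c (N - N)) n (fun i => p (n - i)).
  by rewrite subn0 subnn; apply: geodesic_seq_rev.
have [j jn] := D1P _ (hyperbolic_rel_converse hypE) _ _ _ _
  (quasi_geodesic_seq_rev cq) pg' (N - i) (leq_subr i N).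
by rewrite subKn // => /reach_converse cp; exists (n - j); first exact: leq_subr.
Qed.

Definition seq_joins N c x y := c 0 = x /\ c N = y \/ c 0 = y /\ c N = x.

(** Two consecutive indices allow for a point inside an edge: it is reached from [c i] and leads on
    to [c i']. *)
Lemma quasi_triangle_thin d K M : exists D, forall E, hyperbolic_rel E d K ->
  forall x y z N c Nq cq Nr cr,
  quasi_geodesic_seq E M N c -> quasi_geodesic_seq E M Nq cq ->
  quasi_geodesic_seq E M Nr cr ->
  c 0 = x -> c N = y -> seq_joins Nq cq x z -> seq_joins Nr cr y z ->
  forall i i', i <= i' <= N -> i' <= i.+1 ->
  (exists2 j, j <= Nq & reach E D (cq j) (c i)) \/
  (exists2 j, j <= Nr & reach E D (c i') (cr j)).
Proof.
have [D0 D0P] := @morse_seq V d K M.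
have [D1 D1P] := quasi_near_geodesic d K M.
exists (D0 + D1 + d.*2 + d + 1 + K (D1.*2 + M)) => E hypE x y z N c Nq cq Nr cr.
move=> c_q cq_q cr_q cx cy cqxz cryz i i' ii' i'i.
have [thinE outE _] := hypE.
have geod L c' : quasi_geodesic_seq E M L c' ->
    exists n p, geodesic_seq E (c' 0) (c' L) n p.
  move=> [step _]; have [|n [p [_ pg]]] := geodesic_seq_exists (chain_reach step (_ : 0 <= L <= L)).
    by rewrite leqnn.
  by exists n, p.
have [n [p pg]] := geod _ _ c_q.
have [m [q qg]] := geod _ _ cq_q.
have [l [r rg]] := geod _ _ cr_q.
have qb : between E (c 0) z m q.
  by rewrite cx; case: cqxz => -[<- <-]; [left|right].
have rb : between E (c N) z l r.
  by rewrite cy; case: cryz => -[<- <-]; [left|right].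
have [|[a an pc] _] := D1P E hypE _ _ _ _ c_q pg i; first by lia.
have [|_ [b bn cp]] := D1P E hypE _ _ _ _ c_q pg i'; first by lia.
have to_r k j B : j <= l -> reach E B (c i') (p k) -> reach E (d.*2 + d + 1) (p k) (r j) ->
    B <= D1 + K (D1.*2 + M) -> exists2 j, j <= Nr &
    reach E (D0 + D1 + d.*2 + d + 1 + K (D1.*2 + M)) (c i') (cr j).
  move=> jl cpk pr BK; have [[j' j'N rc] _] := D0P E hypE _ _ _ _ cr_q rg j jl.
  by exists j' => //; apply: reach_leq (reach_cat cpk (reach_cat pr rc)); lia.
have [[j jm qp]|[j jl pr]] := thinE _ _ _ _ _ _ _ _ _ pg qb rb a an.
  have [_ [j' j'N cq']] := D0P E hypE _ _ _ _ cq_q qg j jm.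
  by left; exists j' => //; apply: reach_leq (reach_cat cq' (reach_cat qp pc)); lia.
right; have [ab|ba] := leqP a b.
  have [|j' j'l pr'] := stays_close hypE pg rb (_ : a <= b <= n) jl pr; first by lia.
  by apply: (to_r b j' D1) => //; [apply: reach_leq pr'; lia|lia].
(* The path through [p a], [c i], [c i'], [p b] puts [p b] in an out-ball around [p a], so
   divergence bounds the way on from [p b] to [p a]. *)
apply: (to_r a j (D1 + K (D1.*2 + M))) => //; last by apply: reach_leq pr; lia.
apply: (reach_cat cp).
have cc : reach E M (c i) (c i').
  have [step _] := c_q; apply: reach_leq (chain_reach step ii').
  by rewrite -{2}(muln1 M) leq_mul2l; apply/orP; right; lia.
have ba' : reach E (a - b) (p b) (p a) by apply: geodesic_seq_reach pg _; lia.
apply: outE ba'; last exact: reachxx.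
by apply: reach_leq (reach_cat pc (reach_cat cc cp)); lia.
Qed.

(** One finite type labels the neighbours of every vertex, so the bound is uniform and balls are
    labelled by products. *)
Definition bounded_degree E := exists T : finType,
  forall x, exists f : T -> V, forall y, E x y -> exists h, f h = y.

Lemma bounded_degree_balls E m : bounded_degree E -> exists T : finType,
  forall x, exists f : T -> V, forall y, reach E m x y -> exists h, f h = y.
Proof.
move=> [T TP]; elim: m => [|m [Tm TmP]].
  by exists unit => x; exists (fun=> x) => y /= ->; exists tt.
exists (option T * Tm)%type => x.
have [f fP] := TP x; have [F FP] := choice TmP.
exists (fun hg => F (if hg.1 is Some h then f h else x) hg.2) => y /=.
case=> [<-|[w /fP[h fh] /FP[g gy]]].
  by have [g gx] := FP x x (reachxx _ _ _); exists (None, g).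
by exists (Some h, g) => /=; rewrite fh.
Qed.

Lemma geodesic_seq_card E x y n p (T : finType) (f : T -> V) :
  geodesic_seq E x y n p -> (forall i, i <= n -> exists h, f h = p i) -> n < #|T|.
Proof.
move=> pg pf; have [g gP] := choice (fun i : 'I_n.+1 => pf i (ltn_ord i)).
have ginj : injective g.
  have key (i j : 'I_n.+1) : g i = g j -> i <= j -> i = j.
    move=> e ij; have pij : p i = p j by rewrite -!gP e.
    have ijn : i <= j <= n by rewrite ij /= -ltnS.
    have : reach E 0 (p i) (p j) by rewrite pij.
    by move/(geodesic_seq_leq pg ijn) => ji; apply: val_inj => /=; lia.
  move=> i j e; have [ij|ji] := leqP i j; first exact: key.
  by apply/esym/key => //; exact: ltnW.
by have := leq_card g ginj; rewrite card_ord.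
Qed.

(** In the triangle [x], [u], [v] each point of the geodesic from [u] to [v] lies in the out-ball of
    radius [k + d] around [x], or in an in-ball of radius [d] around a point of the out-ball of
    radius [k]. These sets have bounded size, hence so has the geodesic. *)
Lemma thin_seqs_divergence E d : thin_seqs E d ->
  bounded_degree E -> bounded_degree (converse_rel E) ->
  exists K, bounded_divergence E K.
Proof.
move=> thinE outE inE.
suff /choice[K KP] : forall k, exists B, forall m x u v,
    reach E k x u -> reach E k x v -> reach E m u v -> reach E B u v.
  by exists K => k; exact: KP.
move=> k; have [T1 T1P] := bounded_degree_balls (k + d) outE.
have [T2 T2P] := bounded_degree_balls k outE.
have [T3 T3P] := bounded_degree_balls d inE.
exists #|{: T1 + T2 * T3}| => m x u v xu xv uv.
have [n [p [_ pg]]] := geodesic_seq_exists uv.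
have [f1 f1P] := T1P x; have [f2 f2P] := T2P x; have [f3 f3P] := choice T3P.
have [a [q [ak qg]]] := geodesic_seq_exists xu.
have [b [r [bk rg]]] := geodesic_seq_exists xv.
pose f (h : T1 + T2 * T3) := match h with inl h1 => f1 h1 | inr h => f3 (f2 h.1) h.2 end.
have nT : n < #|{: T1 + T2 * T3}|.
  apply: (geodesic_seq_card (f := f) pg) => i ni.
  have [[j ja qp]|[j jb pr]] := thinE _ _ _ _ _ _ _ _ _ pg (or_intror qg) (or_intror rg) i ni.
    have /f1P[h e] : reach E (k + d) x (p i); last by exists (inl h).
    apply: reach_leq (reach_cat _ qp); last first.
      by case: (qg) => <- _ _ _; apply: (geodesic_seq_reach qg (_ : 0 <= j <= a)).
    by lia.
  have /f2P[h2 e2] : reach E k x (r j).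
    apply: (@reach_leq _ _ (j - 0)); first by lia.
    by case: (rg) => <- _ _ _; apply: (geodesic_seq_reach rg (_ : 0 <= j <= b)).
  have /f3P[h3 e3] : reach (converse_rel E) d (r j) (p i) by exact/reach_converse.
  by exists (inr (h2, h3)) => /=; rewrite e2.
case: (pg) => <- <- _ _; apply: (@reach_leq _ _ (n - 0)); first by lia.
by apply: (geodesic_seq_reach pg _); lia.
Qed.

Lemma thin_seqs_hyperbolic E d : thin_seqs E d ->
  bounded_degree E -> bounded_degree (converse_rel E) ->
  exists K, hyperbolic_rel E d K.
Proof.
move=> thinE outE inE.
have [K1 K1P] := thin_seqs_divergence thinE outE inE.
have thinE' := thin_seqs_converse thinE.
have [K2 K2P] := thin_seqs_divergence thinE' inE outE.
exists (fun k => maxn (K1 k) (K2 k)); split=> // k m x u v xu xv uv.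
  by apply: reach_leq (K1P k m x u v xu xv uv); rewrite leq_maxl.
by apply: reach_leq (K2P k m x u v xu xv uv); rewrite leq_maxr.
Qed.

End Triangles.

(** * Curves in a semimetric space *)

Local Open Scope ring_scope.

Section SemimetricNbhs.
Context {R : realType} {X : Type}.
Implicit Types d : semimetric R X.

Lemma dist_xx d x : d x x = 0%E.
Proof. exact/dist_eq0. Qed.

Lemma ball_shrink d z x (r : R) : (d z x < r%:E)%E ->
  exists2 e : R, 0 < e & forall y, (d x y < e%:E)%E -> (d z y < r%:E)%E.
Proof.
case E : (d z x) (dist_ge0 d z x) => [a||] //; rewrite lte_fin => a0 ar.
exists (r - a); first by rewrite subr_gt0.
move=> y xy; apply: le_lt_trans (dist_triangle d z x y) _; rewrite E.
by move: xy; case: (d x y) => [b||] //; rewrite -?EFinD ?lte_fin ?ltNyr // => ?; lra.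
Qed.

(** Exchanges the forward and the backward topology. *)
Definition converse_dist d : semimetric R X :=
  @Semimetric R X (fun x y => d y x) (fun x y => dist_ge0 d y x)
    (fun x y => iff_trans (dist_eq0 d y x) (conj (@esym _ _ _) (@esym _ _ _)))
    (fun x y z => eq_ind_r (fun b => (d z x <= b)%E) (dist_triangle d z y x) (addeC _ _)).

Lemma common_radius (I : eqType) (s : seq I) (P : I -> set X) (f : X -> \bar R) :
  (forall i, i \in s -> exists2 e : R, 0 < e & forall y, (f y < e%:E)%E -> P i y) ->
  exists2 e : R, 0 < e & forall y, (f y < e%:E)%E -> forall i, i \in s -> P i y.
Proof.
elim: s => [|i s IH] sP; first by exists 1.
have [j js|e1 e10 e1P] := IH; first by apply: sP; rewrite inE js orbT.
have [e2 e20 e2P] := sP i (mem_head _ _).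
exists (Num.min e1 e2) => [|y]; first by rewrite lt_min e10.
rewrite EFin_min lt_min => /andP[y1 y2] j; rewrite inE => /predU1P[->|]; first exact: e2P.
exact: e1P.
Qed.

Lemma forward_nbhsP d (x : forward_space d) (A : set (forward_space d)) :
  nbhs x A <-> exists2 e : R, 0 < e & forall y, (d x y < e%:E)%E -> A y.
Proof.
split=> [|[e e0 xA]]; last first.
  rewrite nbhsE /=; exists [set y | (d x y < e%:E)%E]; last by move=> y; exact: xA.
  split; last by rewrite /= dist_xx lte_fin.
  exists [set [set y | (d x y < e%:E)%E]]; last by rewrite bigcup_set1.
  move=> _ -> /=; exists [fset [set y | (d x y < e%:E)%E]]%fset.
    by move=> U /fset1P ->; apply/mem_set; exists x, e.
  rewrite predeqE => y; split=> [h|xy U]; first by apply: h; exact: fset11.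
  by move=> /fset1P ->.
rewrite nbhsE /= => -[B [[D' DD' <-] [U D'U xU]] BA].
have [F FD Fe] := DD' _ D'U.
have small i : i \in enum_fset F ->
    exists2 e : R, 0 < e & forall y, (d x y < e%:E)%E -> i y.
  move=> iF; have : i x by move: xU; rewrite -Fe; apply.
  have : i \in F by [].
  by move=> /FD/set_mem[z [r ->]]; exact: ball_shrink.
have [e e0 eP] := common_radius small; exists e => // y xy.
have Uy : U y by rewrite -Fe => i iF; exact: eP.
by apply: BA; exists U.
Qed.

Lemma backward_nbhsP d (x : backward_space d) (A : set (backward_space d)) :
  nbhs x A <-> exists2 e : R, 0 < e & forall y, (d y x < e%:E)%E -> A y.
Proof. exact: (@forward_nbhsP (converse_dist d) x A). Qed.

End SemimetricNbhs.

Section DirectedPaths.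
Context {R : realType} {X : Type} (d : semimetric R X).
Implicit Types P : curve R X.

(** Distances in the interval are infinite against its direction, so forward continuity at [s]
    constrains only later parameters and backward continuity only earlier ones. *)
Lemma directed_pathP P : directed_path d P <->
  lo P <= hi P /\ forall s, lo P <= s <= hi P -> forall e : R, 0 < e ->
    exists2 h : R, 0 < h & forall t, lo P <= t <= hi P ->
      (s <= t -> t < s + h -> (d (P s) (P t) < e%:E)%E) /\
      (t <= s -> s < t + h -> (d (P t) (P s) < e%:E)%E).
Proof.
split=> [[lohi fc bc]|[lohi near]].
  split=> // s sP e e0.
  have sI : s \in `[lo P, hi P]%classic by rewrite inE /= in_itv.
  pose s' : `[lo P, hi P]%classic := exist _ s sI.
  have [h1 h10 h1P] : exists2 h : R, 0 < h & forall y,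
      (interval_semimetric (lo P) (hi P) s' y < h%:E)%E ->
      (d (P s) (on_domain y) < e%:E)%E.
    have N : nbhs (on_domain s' : forward_space d) [set y | (d (P s) y < e%:E)%E].
      by apply/forward_nbhsP; exists e.
    by have /forward_nbhsP := fc s' _ N.
  have [h2 h20 h2P] : exists2 h : R, 0 < h & forall y,
      (interval_semimetric (lo P) (hi P) y s' < h%:E)%E ->
      (d (on_domain y) (P s) < e%:E)%E.
    have N : nbhs (on_domain s' : backward_space d) [set y | (d y (P s) < e%:E)%E].
      by apply/backward_nbhsP; exists e.
    by have /backward_nbhsP := bc s' _ N.
  exists (Num.min h1 h2); first by rewrite lt_min h10.
  move=> t tP; have tI : t \in `[lo P, hi P]%classic by rewrite inE /= in_itv.
  split=> st th.
    have := h1P (exist _ t tI); apply; rewrite /= /interval_dist /= st lte_fin.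
    by move: th; rewrite minElt; case: ifP => ?; lra.
  have := h2P (exist _ t tI); apply; rewrite /= /interval_dist /= st lte_fin.
  by move: th; rewrite minElt; case: ifP => ?; lra.
have rangeP (s : `[lo P, hi P]%classic) : lo P <= val s <= hi P.
  by case: s => s /=; rewrite inE /= in_itv.
split=> // s A.
  move=> /forward_nbhsP[e e0 eA].
  have [h h0 hP] := near _ (rangeP s) e e0.
  apply/forward_nbhsP; exists h => // t; rewrite /= /interval_dist.
  case: ifP => // st; rewrite lte_fin => th; apply: eA.
  by have [+ _] := hP _ (rangeP t); apply => //; lra.
move=> /backward_nbhsP[e e0 eA].
have [h h0 hP] := near _ (rangeP s) e e0.
apply/backward_nbhsP; exists h => // t; rewrite /= /interval_dist.
case: ifP => // st; rewrite lte_fin => th; apply: eA.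
by have [_] := hP _ (rangeP t); apply => //; lra.
Qed.

Lemma unit_speed_geodesic P : lo P <= hi P ->
  (forall s t, lo P <= s -> s <= t -> t <= hi P -> d (P s) (P t) = (t - s)%:E) ->
  geodesic d P.
Proof.
move=> lohi speed; split.
  apply/directed_pathP; split=> // s /andP[ls sh] e e0; exists e => // t /andP[lt th].
  by split=> st ts; rewrite speed // lte_fin; lra.
move=> s t ls st th; rewrite speed //; apply: cvg_near_cst; near=> N.
have N0 : (0 : R) < N%:R by rewrite ltr0n; near: N; exists 1%N.
rewrite /length_sum (eq_bigr (fun=> ((t - s) / N%:R)%:E)) => [|i _].
  by rewrite sumEFin big_const_ord iter_addr addr0 -[(_ / _) *+ N]mulr_natr divfK // lt0r_neq0.
have iN : (i.+1%:R : R) <= N%:R by rewrite ler_nat.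
have step : i.+1%:R * (t - s) / N%:R - i%:R * (t - s) / N%:R = (t - s) / N%:R :> R.
  by rewrite -mulrBl -mulrBl -natrB // subSnn mul1r.
have i0 : 0 <= i%:R * (t - s) / N%:R :> R.
  by rewrite divr_ge0 ?mulr_ge0 ?ler0n ?subr_ge0 // ltW.
have ts0 : 0 <= (t - s) / N%:R :> R by rewrite divr_ge0 ?subr_ge0 // ltW.
have i1 : i.+1%:R * (t - s) / N%:R <= t - s.
  by rewrite ler_pdivrMr // mulrC ler_wpM2l // subr_ge0.
by rewrite speed; [congr EFin|..]; lra.
Unshelve. all: by end_near. Qed.

End DirectedPaths.

(** The two steps match the one-sided information that forward and backward continuity give along a
    directed path. *)
Lemma real_induction (R : realType) (a b : R) (Q : R -> Prop) : a <= b -> Q a ->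
  (forall s, a <= s -> s < b -> Q s ->
     exists2 h, 0 < h & forall t, s < t -> t < s + h -> t <= b -> Q t) ->
  (forall s, a < s -> s <= b -> (forall t, a <= t -> t < s -> Q t) -> Q s) ->
  forall t, a <= t <= b -> Q t.
Proof.
move=> ab Qa right left.
pose E := [set t | a <= t <= b /\ forall t', a <= t' -> t' <= t -> Q t'].
have Ea : E a by split=> [|t' at' t'a]; [rewrite lexx|have -> : t' = a by lra].
have ubE : has_ubound E by exists b => t [/andP[]].
have supE : has_sup E by split=> //; exists a.
set m := sup E.
have am : a <= m by exact: ub_le_sup.
have mb : m <= b by apply: ge_sup; [exists a|move=> t [/andP[]]].
have Qbelow t : a <= t -> t < m -> Q t.
  move=> at_ tm; have [|e [_ eQ] te] := @sup_adherent _ E (m - t) _ supE.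
    by rewrite subr_gt0.
  by apply: eQ => //; move: te; rewrite -/m; lra.
have Qm : Q m.
  have [<-//|am'] := eqVneq a m.
  by apply: left => //; rewrite lt_neqAle am' am.
have [bm|mb'] := leP b m.
  move=> t /andP[at_ tb]; have [tm|mt] := ltP t m; first exact: Qbelow.
  by have -> : t = m by lra.
have [h h0 Qh] := right m am mb' Qm.
pose t1 := Num.min b (m + h / 2).
have [t1b t1h mt1] : [/\ t1 <= b, t1 < m + h & m < t1].
  by rewrite /t1 minElt; case: ifP => ?; split; lra.
suff /(ub_le_sup ubE) : E t1 by rewrite -/m; lra.
split=> [|t' at' t't1]; first by lra.
have [t'm|mt'] := ltP t' m; first exact: Qbelow.
have [->//|nt'] := eqVneq t' m.
by apply: Qh; [rewrite lt_neqAle eq_sym nt' mt'|lra|lra].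
Qed.

(** * Additivity and intermediate values of the distance along a geodesic *)

Section GeodesicCurves.
Context {R : realType} {X : Type} (d : semimetric R X).
Variable P : curve R X.
Hypothesis geoP : geodesic d P.
Let a := lo P.
Let b := hi P.

Let near s : a <= s <= b -> forall e : R, 0 < e ->
  exists2 h : R, 0 < h & forall t, a <= t <= b ->
    (s <= t -> t < s + h -> (d (P s) (P t) < e%:E)%E) /\
    (t <= s -> s < t + h -> (d (P t) (P s) < e%:E)%E).
Proof. by case: geoP => /directed_pathP[_ + _]; apply. Qed.

Lemma dist_sum (g : nat -> X) m n : (m <= n)%N ->
  (d (g m) (g n) <= \sum_(m <= i < n) d (g i) (g i.+1))%E.
Proof.
elim: n => [|n IH]; first by rewrite leqn0 => /eqP ->; rewrite big_geq // dist_xx.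
rewrite leq_eqVlt => /predU1P[->|mn]; first by rewrite big_geq // dist_xx.
rewrite big_nat_recr //=; apply: le_trans (dist_triangle d _ (g n) _) _.
by rewrite leeD2r // IH.
Qed.

(* In a fine equipartition of [s, u] the two ends of the part containing t are close
   to t, so the length sums are at least d (P s) (P t) + d (P t) (P u) - e. *)
Lemma geodesic_additive s t u : a <= s -> s <= t -> t <= u -> u <= b ->
  d (P s) (P u) = (d (P s) (P t) + d (P t) (P u))%E.
Proof.
move=> as_ st tu ub; apply/le_anti; rewrite dist_triangle /=.
have [su|su] := eqVneq s u.
  by have [-> ->] : t = s /\ u = s; [split; lra|rewrite !dist_xx adde0].
have {}su : s < u by rewrite lt_neqAle su (le_trans st).
apply/lee_addgt0Pr => e e0.
have e20 : 0 < e / 2 by rewrite divr_gt0.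
have [|h h0 hP] := near (_ : a <= t <= b) e20; first by lra.
have [_ /(_ s u as_ (ltW su) ub)] := geoP; rewrite /has_length => lim.
rewrite -leeBlDr //; apply: cvge_ge lim; near=> N.
have Nbig : (u - s) / h < N%:R.
  by near: N; exact: nbhs_infty_gtr.
have N0 : (0 : R) < N%:R by apply: le_lt_trans Nbig; rewrite divr_ge0 ?subr_ge0 ?ltW.
have mesh : (u - s) / N%:R < h by rewrite ltr_pdivrMr // mulrC -ltr_pdivrMr.
rewrite leeBlDr //.
pose g (i : nat) := s + i%:R * (u - s) / N%:R.
have gS i : g i.+1 = g i + (u - s) / N%:R.
  by rewrite /g -addrA -mulrA -natr1 mulrDl mul1r -mulrA.
have g0 : g 0%N = s by rewrite /g !mul0r addr0.
have gN : g N = u by rewrite /g mulrAC divff ?lt0r_neq0 // mul1r addrC subrK.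
have mesh0 : 0 < (u - s) / N%:R by rewrite divr_gt0 // subr_gt0.
have [k kN [gk gk1]] : exists2 k, (k < N)%N & g k <= t /\ t <= g k.+1.
  have ex : exists k, t <= g k.+1.
    by exists N; rewrite gS gN; lra.
  case: (ex_minnP ex) => k tk kmin; exists k.
    rewrite ltnNge; apply/negP => Nk.
    have N1 : (0 < N)%N by rewrite -(ltr_nat R).
    have gt : t <= g N.-1.+1 by rewrite prednK // gN.
    by move: (kmin _ gt) Nk N1; clear; lia.
  split=> //; case: k tk kmin => [|k] tk kmin; first by rewrite g0.
  by rewrite leNgt; apply/negP => /ltW /kmin; rewrite ltnn.
have g_ge i : s <= g i.
  elim: i => [|i IH]; rewrite ?g0 // gS; lra.
have g_le i : (i <= N)%N -> g i <= u.
  move=> iN; have : (i%:R : R) <= N%:R by rewrite ler_nat.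
  move=> iNR; rewrite /g -lerBrDl ler_pdivrMr // mulrC ler_wpM2l // subr_ge0; lra.
have g_dom i : (i <= N)%N -> a <= g i <= b.
  by move=> /g_le giu; rewrite (le_trans as_ (g_ge i)) (le_trans giu ub).
have [_ near_left] := hP (g k) (g_dom k (ltnW kN)).
have [near_right _] := hP (g k.+1) (g_dom k.+1 kN).
have left_lt : (d (P (g k)) (P t) < (e / 2)%:E)%E by apply: near_left => //; rewrite gS in gk1; lra.
have right_lt : (d (P t) (P (g k.+1)) < (e / 2)%:E)%E by apply: near_right => //; rewrite gS; lra.
have -> : length_sum d P s u N = (\sum_(0 <= i < N) d (P (g i)) (P (g i.+1)))%E.
  by rewrite /length_sum big_mkord.
have kN' : (k.+1 <= N)%N by [].
have sum_ge : (d (P s) (P (g k)) + d (P (g k.+1)) (P u) <=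
    \sum_(0 <= i < N) d (P (g i)) (P (g i.+1)))%E.
  rewrite (big_cat_nat (n := k)) //=; last exact: ltnW.
  rewrite (big_ltn kN) /= leeD //.
    by rewrite -{1}g0; apply: (dist_sum (fun i => P (g i))).
  rewrite -{1}gN; apply: le_trans (dist_sum (fun i => P (g i)) kN') _.
  by rewrite leeDr // dist_ge0.
apply: (@le_trans _ _ (d (P s) (P (g k)) + d (P (g k.+1)) (P u) + e%:E)%E); last by rewrite leeD2r.
apply: (@le_trans _ _ ((d (P s) (P (g k)) + (e / 2)%:E) + ((e / 2)%:E + d (P (g k.+1)) (P u)))%E).
  apply: leeD.
    by apply: le_trans (dist_triangle d _ (P (g k)) _) _; rewrite leeD2l // ltW.
  by apply: le_trans (dist_triangle d _ (P (g k.+1)) _) _; rewrite leeD2r // ltW.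
rewrite addeA -(addeA (d (P s) (P (g k)))) -EFinD (_ : e / 2 + e / 2 = e); last by lra.
by rewrite -addeA [(e%:E + _)%E]addeC addeA.
Unshelve. all: end_near.
Qed.

Lemma geodesic_finite s : a <= s <= b -> (d (P a) (P s) < +oo)%E.
Proof.
have [/directed_pathP[ab _] _] := geoP.
move: s; apply: (@real_induction _ a b (fun t => (d (P a) (P t) < +oo)%E)) => //.
  by rewrite dist_xx ltry.
  move=> s' as' s'b fs; have [|h h0 hP] := near (_ : a <= s' <= b) ltr01; first by lra.
  exists h => // t st th tb; have tab : a <= t <= b by lra.
  have [+ _] := hP t tab.
  move=> /(_ (ltW st) th) dt; apply: le_lt_trans (dist_triangle d _ (P s') _) _.
  by rewrite lte_add_pinfty // (lt_trans dt) // ltry.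
move=> s' as' s'b fin; have [|h h0 hP] := near (_ : a <= s' <= b) ltr01; first by lra.
pose t := Num.max a (s' - h / 2).
have [at_ ts th] : [/\ a <= t, t < s' & s' < t + h].
  by rewrite /t maxElt; case: ifP => ?; split; lra.
have tab : a <= t <= b by lra.
  have [_] := hP t tab; move=> /(_ (ltW ts) th) dt.
apply: le_lt_trans (dist_triangle d _ (P t) _) _.
by rewrite lte_add_pinfty // ?fin // (lt_trans dt) // ltry.
Qed.

(** If [v] is missed, the distance stays below [v]: forward continuity preserves this to the right,
    and backward continuity gives at most [v] in the limit, where equality is excluded. *)
Lemma geodesic_ivt (v : R) : 0 <= v -> (v%:E <= d (P a) (P b))%E ->
  exists2 t, a <= t <= b & d (P a) (P t) = v%:E.
Proof.
have [/directed_pathP[ab _] _] := geoP.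
move=> v0 vb; apply: contrapT => nex.
have neq t : a <= t <= b -> d (P a) (P t) != v%:E.
  by move=> tab; apply/eqP => e; apply: nex; exists t.
suff : forall t, a <= t <= b -> (d (P a) (P t) < v%:E)%E.
  by move=> /(_ b); rewrite lexx ab => /(_ isT); rewrite ltNge vb.
apply: (@real_induction _ a b (fun t => (d (P a) (P t) < v%:E)%E)) => //.
- have := neq a; rewrite lexx ab dist_xx => /(_ isT) nv.
  by rewrite lte_fin lt_neqAle v0 andbT; apply: contra nv => /eqP <-.
- move=> s as_ sb ds.
  have [e e0 eP] := ball_shrink ds.
  have [|h h0 hP] := near (_ : a <= s <= b) e0; first by lra.
  exists h => // t st th tb; apply: eP.
  have tab : a <= t <= b by lra.
  by have [+ _] := hP t tab; apply => //; lra.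
- move=> s as_ sb dlt; rewrite lt_neqAle neq /=; last by lra.
  apply/lee_addgt0Pr => e e0; have [|h h0 hP] := near (_ : a <= s <= b) e0; first by lra.
  pose t := Num.max a (s - h / 2).
  have [at_ ts th] : [/\ a <= t, t < s & s < t + h].
    by rewrite /t maxElt; case: ifP => ?; split; lra.
  have tab : a <= t <= b by lra.
  have [_] := hP t tab; move=> /(_ (ltW ts) th) dt.
  apply: le_trans (dist_triangle d _ (P t) _) _.
  by apply: leeD; apply: ltW => //; apply: dlt.
Qed.

Lemma geodesic_dist_diff s t (u v : R) : a <= s <= b -> a <= t <= b ->
  d (P a) (P s) = u%:E -> d (P a) (P t) = v%:E -> u <= v ->
  d (P s) (P t) = (v - u)%:E.
Proof.
move=> sab tab su tv uv; have [st|ts] := leP s t.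
  have := @geodesic_additive a s t (lexx _) _ st _; rewrite su tv.
  move=> /(_ ltac:(lra) ltac:(lra)).
  by case: (d (P s) (P t)) => [w||] //; rewrite -EFinD => -[->]; congr EFin; lra.
(* The later parameter has no larger distance, so by additivity the two points coincide. *)
have := @geodesic_additive a t s (lexx _) _ (ltW ts) _; rewrite su tv.
move=> /(_ ltac:(lra) ltac:(lra)).
have := dist_ge0 d (P t) (P s); case E : (d (P t) (P s)) => [w||] //.
rewrite lee_fin -EFinD => w0 -[uvw].
have w0' : w = 0 by lra.
move: E; rewrite w0' => /dist_eq0 ->; rewrite dist_xx; congr EFin; lra.
Qed.

End GeodesicCurves.

(** * Curves in a digraph *)

Section DigraphReach.
Context {R : realType} {G : digraph}.
Implicit Types (u v x y : vertex G) (p q r : nat -> vertex G).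

Definition edge_rel u v := exists2 e : edge G, tail e = u & head e = v.

Lemma reach_walk n u v :
  reach edge_rel n u v <-> exists2 m, (m <= n)%N & walk m u v.
Proof.
split.
  elim: n u => [|n IH] u /=; first by move=> uv; exists 0%N.
  case=> [uv|[w [e eu ew] /IH[m mn wv]]]; first by exists 0%N.
  by exists m.+1 => //=; exists e; rewrite ew.
case=> m mn uv; apply: (reach_leq mn); elim: m u uv {mn} => [//|m IH] u [e [eu ev]].
by right; exists (head e); [exists e|exact: IH].
Qed.

Lemma vertex_dist_leP n u v : (vertex_dist R u v <= n%:R%:E)%E <-> reach edge_rel n u v.
Proof.
split=> [|/reach_walk[m mn uv]]; last first.
  by apply: le_trans (vertex_dist_le (R := R) uv) _; rewrite lee_fin ler_nat.
have [[m [uv ->]]|->] := vertex_distP (R := R) u v; last by rewrite leye_eq.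
by rewrite lee_fin ler_nat => mn; apply/reach_walk; exists m.
Qed.

Lemma vertex_dist_reach u v (a : R) :
  vertex_dist R u v = a%:E -> exists2 n, a = n%:R & reach edge_rel n u v.
Proof.
have [[m [uv ->]]|->//] := vertex_distP (R := R) u v.
by move=> [<-]; exists m => //; apply/reach_walk; exists m.
Qed.

Lemma geodesic_seq_dist x y n p i j : geodesic_seq edge_rel x y n p ->
  (i <= j <= n)%N -> vertex_dist R (p i) (p j) = (j - i)%:R%:E.
Proof.
move=> pg ij; apply/le_anti/andP; split.
  by apply/vertex_dist_leP; apply: geodesic_seq_reach pg ij.
have [[m [uv ->]]|->] := vertex_distP (R := R) (p i) (p j); last exact: leey.
rewrite lee_fin ler_nat; apply: (geodesic_seq_leq pg ij).
by apply/reach_walk; exists m.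
Qed.

Lemma dist_Vertex u v : @digraph_dist R G (Vertex R u) (Vertex R v) = vertex_dist R u v.
Proof. by rewrite /= /through_dist /= add0e adde0. Qed.

Lemma dist_to_Vertex (z : point R G) v :
  digraph_dist z (Vertex R v) = ((to_next z)%:E + vertex_dist R (next_vertex z) v)%E.
Proof. by case: z => [u|e t ht]; rewrite /= /through_dist /= ?adde0. Qed.

Lemma dist_from_Vertex (z : point R G) v :
  digraph_dist (Vertex R v) z = (vertex_dist R v (prev_vertex z) + (from_prev z)%:E)%E.
Proof. by case: z => [u|e t ht]; rewrite /= /through_dist /= ?add0e. Qed.

Lemma geodesic_seq_curve x y n p : geodesic_seq edge_rel x y n p ->
  exists P : curve R (point R G),
    [/\ geodesic (digraph_semimetric (G := G)) P, start P = Vertex R x, finish P = Vertex R y,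
        forall i, (i <= n)%N -> image P (Vertex R (p i)) &
        forall z, image P z -> (exists2 i, (i <= n)%N & next_vertex z = p i) /\
                               (exists2 i, (i <= n)%N & prev_vertex z = p i)].
Proof.
move=> pg.
have [e eP] : exists e : nat -> option (edge G), forall k, (k < n)%N ->
    exists2 f, e k = Some f & tail f = p k /\ head f = p k.+1.
  suff /choice[e eP] : forall k, exists o : option (edge G), (k < n)%N ->
    exists2 f, o = Some f & tail f = p k /\ head f = p k.+1 by exists e.
  move=> k; have [kn|nk] := ltnP k n; last by exists None.
  have : reach edge_rel (k.+1 - k) (p k) (p k.+1) by apply: geodesic_seq_reach pg _; lia.
  rewrite subSnn /=; case=> [pp|[_ [f fk <-] <-]]; last by exists (Some f) => _; exists f.
  have : (k.+1 - k <= 0)%N by apply: (geodesic_seq_leq pg); [lia|exact: pp].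
  by rewrite subSnn.
pose F (t : R) : point R G := let k := Num.truncn t in
  match pselect (0 < t - k%:R < 1), e k with
  | left h, Some f => Inner f h
  | _, _ => Vertex R (p k)
  end.
have FV k : F k%:R = Vertex R (p k).
  by rewrite /F natrK; case: pselect => // h; exfalso; move: h; rewrite subrr ltxx.
have FP t : 0 <= t <= n%:R -> (exists2 k, (k <= n)%N & t = k%:R) \/
    exists k f (h : 0 < t - k%:R < 1),
      [/\ (k < n)%N, e k = Some f, tail f = p k, head f = p k.+1 & F t = Inner f h].
  move=> /andP[t0 tn]; have /andP[kt tk] := truncn_itv t0; set k := Num.truncn t in kt tk.
  have [tk'|tk'] := eqVneq t k%:R; first by left; exists k => //; rewrite -(ler_nat R) -tk'.
  have h : 0 < t - k%:R < 1.
    by rewrite subr_gt0 lt_neqAle eq_sym tk' kt ltrBlDl natr1.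
  have kn : (k < n)%N by rewrite -(ltr_nat R); move/andP: h; lra.
  have [f ef [ft fh]] := eP k kn.
  right; exists k, f, h; split=> //; rewrite /F -/k ef.
  by case: pselect => // h'; congr Inner; exact: bool_irrelevance.
have speed s t : 0 <= s -> s <= t -> t <= n%:R -> digraph_dist (F s) (F t) = (t - s)%:E.
  move=> s0 st tn.
  have /FP[[k kn sk]|[k [f [hs [kn ek fk fk1 ->]]]]] : 0 <= s <= n%:R by lra.
    have /FP[[l ln tl]|[l [g [ht [ln el gl gl1 ->]]]]] : 0 <= t <= n%:R by lra.
      have kl : (k <= l)%N by rewrite -(ler_nat R) -sk -tl.
      by rewrite sk tl !FV dist_Vertex (geodesic_seq_dist pg) ?kl ?ln // natrB.
    have kl : (k <= l)%N by rewrite -ltnS -(ltr_nat R) -natr1; move/andP: ht; lra.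
    rewrite sk FV dist_from_Vertex /= gl (geodesic_seq_dist pg) ?kl ?(ltnW ln) //.
    by rewrite natrB // -EFinD; congr EFin; lra.
  have /FP[[l ln tl]|[l [g [ht [ln el gl gl1 ->]]]]] : 0 <= t <= n%:R by lra.
    have kl : (k < l)%N by rewrite -(ltr_nat R); move/andP: hs; lra.
    rewrite tl FV dist_to_Vertex /= fk1 (geodesic_seq_dist pg) ?kl ?ln // natrB //.
    by rewrite -natr1 -EFinD; congr EFin; lra.
  have kl : (k <= l)%N.
    by rewrite -ltnS -(ltr_nat R) -natr1; move/andP: hs; move/andP: ht; lra.
  rewrite /=; move: kl; rewrite leq_eqVlt => /predU1P[kl|kl].
    subst l; have fg : f = g by move: el; rewrite ek => -[].
    rewrite asboolT //= (_ : s - k%:R <= t - k%:R); last by lra.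
    by congr EFin; lra.
  (* No edge is used twice, since the tails [p k] and [p l] differ. *)
  rewrite asboolF /=; last first.
    move=> fg; have : p k = p l by rewrite -fk -gl fg.
    move=> pkl; have : (l - k <= 0)%N; last by lia.
    by apply: (geodesic_seq_leq pg); [lia|exact: pkl].
  rewrite /through_dist /= fk1 gl (geodesic_seq_dist pg); last by lia.
  by rewrite natrB // -natr1 -!EFinD; congr EFin; lra.
exists (Curve 0 n%:R F); split.
- by apply: unit_speed_geodesic.
- by rewrite /start /= (FV 0%N); case: pg => ->.
- by rewrite /finish /= FV; case: pg => _ ->.
- by move=> i ni; exists i%:R; rewrite /= ?FV // in_itv /= ler0n ler_nat.
- move=> _ [t /= + <-]; rewrite in_itv /= => /FP[[k kn ->]|[k [f [h [kn _ fk fk1 ->]]]]] /=.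
    by rewrite FV /=; split; exists k.
  by split; [exists k.+1|exists k => //; exact: ltnW].
Qed.

End DigraphReach.

Section DigraphCurves.
Context {R : realType} {G : digraph}.
Notation d := (@digraph_dist R G).
Notation geodesic_curve := (geodesic (@digraph_semimetric R G)).
Implicit Types (x y z : point R G) (P : curve R (point R G)).

Lemma to_next_le1 x : to_next x <= 1.
Proof. by case: x => //= e t /andP[t0 _]; lra. Qed.

Lemma from_prev_le1 x : from_prev x <= 1.
Proof. by case: x => //= e t /andP[_ /ltW]. Qed.

Lemma reach_prev_next x : reach (@edge_rel G) 1 (prev_vertex x) (next_vertex x).
Proof. by case: x => [v|e t ht] /=; [left|right; exists (head e) => //; exists e]. Qed.

(** A point [w] of a side that is close to the vertex [p i] may be moved on to [next_vertex w],
    which belongs to the side's sequence and is no farther from [p i]; dually with [prev_vertex]. *)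
Lemma hyperbolic_thin_seqs : hyperbolic_digraph R G -> exists D, thin_seqs (@edge_rel G) D.
Proof.
move=> [delta [delta0 thinG]]; 
have [D deltaD] : exists D : nat, delta <= D%:R.
  by exists (Num.truncn delta).+1; apply/ltW/truncnS_gt.
exists D.
have curve_of (u v : vertex G) n p : between (@edge_rel G) u v n p ->
  exists P : curve R (point R G),
    [/\ geodesic_curve P, joins P (Vertex R u) (Vertex R v),
        forall i, (i <= n)%N -> image P (Vertex R (p i)) &
        forall z, image P z -> (exists2 i, (i <= n)%N & next_vertex z = p i) /\
                               (exists2 i, (i <= n)%N & prev_vertex z = p i)].
  by case=> /(@geodesic_seq_curve R)[P [gP sP fP Pi Pz]]; exists P; split=> //; [left|right].
move=> x y z n m l p q r pg qb rb i ni.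
have [P [gP sP fP Pi Pz]] := @geodesic_seq_curve R _ _ _ _ _ pg.
have [Q [gQ jQ Qi Qz]] := curve_of _ _ _ _ (betweenC qb).
have [Rc [gR jR Ri Rz]] := curve_of _ _ _ _ rb.
pose T (i : 'I_3) := nth P [:: P; Rc; Q] i.
pose c (i : 'I_3) := nth (Vertex R x) [:: Vertex R x; Vertex R y; Vertex R z] i.
have triT : geodesic_triangle (@digraph_semimetric R G) T.
  by exists c => -[[|[|[|//]]] i3]; rewrite /T /c /=; split=> //; left.
pose i0 := @Ordinal 3 0 isT; pose i1 := @Ordinal 3 1 isT; pose i2 := @Ordinal 3 2 isT.
have Qx : endpoint Q (start P).
  by rewrite sP; case: jQ => -[s f]; [right|left].
have Ry : endpoint Rc (finish P).
  by rewrite fP; case: jR => -[s f]; [left|right].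
have [[w Qw]|[w Rw]] := thinG T triT i0 i2 i1 isT Qx Ry _ (Pi i ni).
  move=> wd0; have wd : (d w (Vertex R (p i)) <= delta%:E)%E := wd0.
  rewrite dist_to_Vertex in wd; left.
  have [[j jm e] _] := Qz _ Qw; exists j => //; rewrite -e.
  apply/(@vertex_dist_leP R G _ _ _); apply: le_trans (le_trans wd _); last by rewrite lee_fin.
  by rewrite leeDr // lee_fin to_next_ge0.
move=> wd0; have wd : (d (Vertex R (p i)) w <= delta%:E)%E := wd0.
rewrite dist_from_Vertex in wd; right.
have [_ [j jl e]] := Rz _ Rw; exists j => //; rewrite -e.
apply/(@vertex_dist_leP R G _ _ _); apply: le_trans (le_trans wd _); last by rewrite lee_fin.
by rewrite leeDl // lee_fin from_prev_ge0.
Qed.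

Lemma dist_start_image P z : geodesic_curve P -> image P z ->
  [/\ (d (start P) z < +oo)%E, (d z (finish P) < +oo)%E &
      d (start P) (finish P) = (d (start P) z + d z (finish P))%E].
Proof.
move=> gP [s /=]; rewrite in_itv /= => sab <-.
have /andP[as_ sb] := sab.
have add := geodesic_additive gP (lexx _) as_ sb (lexx _).
have fin_b : (d (P (lo P)) (P (hi P)) < +oo)%E.
  by apply: (geodesic_finite gP); rewrite lexx (le_trans as_ sb).
split=> //; first exact: (geodesic_finite gP).
apply: le_lt_trans fin_b; rewrite [leRHS]add leeDr //; exact: digraph_dist_ge0.
Qed.

(** Curves need not have unit speed, so the vertices are found by their distance [to_next x + i]
    from the start. The first alternative is a segment inside one edge. *)
Lemma geodesic_curve_seq P : geodesic_curve P ->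
  (prev_vertex (start P) = prev_vertex (finish P) /\
   forall z, image P z -> (d (start P) z <= 1)%E) \/
  exists n v, [/\ geodesic_seq (@edge_rel G)
                    (next_vertex (start P)) (prev_vertex (finish P)) n v,
    forall i, (i <= n)%N -> image P (Vertex R (v i)) &
    forall z, image P z -> [\/ (d (start P) z <= 1)%E, (d z (finish P) <= 1)%E |
      exists2 i, (i < n)%N & (d (Vertex R (v i)) z <= 1)%E /\
                             (d z (Vertex R (v i.+1)) <= 1)%E]].
Proof.
move=> gP; set x := start P; set y := finish P.
have [/directed_pathP[ab _] _] := gP.
have bP : lo P <= hi P <= hi P by rewrite lexx ab.
have [dxy|[e [s [t [hs [ht [xE yE st dxy]]]]]]] := digraph_distP x y; last first.
  left; split=> [|z Pz]; first by rewrite xE yE.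
  have [_ _ xzy] := dist_start_image gP Pz.
  apply: (@le_trans _ _ (d x y)).
    by rewrite xzy leeDl //; exact: digraph_dist_ge0.
  have [s0 s1] := andP hs; have [t0 t1] := andP ht.
  by rewrite dxy lee_fin; lra.
right; have := geodesic_finite gP bP; rewrite -/(start P) -/(finish P) -/x -/y.
have [[r [_ vr tr]]|[_ tr]] := through_distP x y; last by rewrite [ltLHS]dxy tr.
have [n rn _] := vertex_dist_reach vr; move=> _; rewrite {r}rn in vr tr.
have {}dxy : d x y = (to_next x + n%:R + from_prev y)%:E by rewrite -tr.
have tx := to_next_ge0 x; have fy := from_prev_ge0 y.
have := fun i : nat => geodesic_ivt gP (v := to_next x + i%:R).
rewrite -/(start P) -/(finish P) -/x -/y => ivt.
have tv i : exists tv : R * vertex G, (i <= n)%N ->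
    [/\ lo P <= tv.1 <= hi P, P tv.1 = Vertex R tv.2 & d x (Vertex R tv.2) = (to_next x + i%:R)%:E].
  have [ni|ni] := leqP i n; last by exists (lo P, next_vertex x).
  have [||t tP dt] := ivt i.
  - by rewrite addr_ge0.
  - rewrite [leRHS]dxy lee_fin.
    by have : (i%:R : R) <= n%:R; [rewrite ler_nat|lra].
  case E : (P t) => [v|f u hu]; first by exists (t, v) => _; rewrite /= -E.
  (* An interior point at position [u] of its edge has distance [to_next x + m + u] with [m] an
     integer, or less than [to_next x] if it follows [x] on the same edge. *)
  exfalso; move: dt; rewrite E => dt.
  have [u0 u1] := andP hu.
  have : (d x (Inner f hu) = (to_next x + i%:R)%:E) by [].
  have [->|[e [s [t' [hs [ht [xE [ef tu] st ->]]]]]]] := digraph_distP x (Inner f hu).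
    have [[r [_ vr' ->]]|[_ ->//]] := through_distP x (Inner f hu).
    have [m -> _] := vertex_dist_reach vr' => -[] /= e.
    have miu : m%:R + u = i%:R :> R by lra.
    have mi : (m < i)%N by rewrite -(ltr_nat R); lra.
    have : (i <= m)%N by rewrite -ltnS -(ltr_nat R) -natr1; lra.
    by lia.
  rewrite xE /= -tu => -[e1].
  have : (0 : R) <= i%:R by [].
  by lra.
have [tv' tvP] := choice tv; pose t i := (tv' i).1; pose v i := (tv' i).2.
have tP i : (i <= n)%N -> lo P <= t i <= hi P by move=> /tvP[].
have Pt i : (i <= n)%N -> P (t i) = Vertex R (v i) by move=> /tvP[].
have dv i : (i <= n)%N -> d x (Vertex R (v i)) = (to_next x + i%:R)%:E by move=> /tvP[].
have dt i : (i <= n)%N -> d (P (lo P)) (P (t i)) = (to_next x + i%:R)%:E.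
  by move=> ni; rewrite Pt // dv.
have dvv i j : (i <= j <= n)%N -> vertex_dist R (v i) (v j) = (j - i)%:R%:E.
  move=> /andP[ij jn]; have ni := leq_trans ij jn.
  rewrite -dist_Vertex -!Pt // natrB //.
  rewrite [LHS](geodesic_dist_diff gP (tP i ni) (tP j jn) (dt i ni) (dt j jn)).
    by congr EFin; lra.
  by rewrite lerD2l ler_nat.
have v0 : v 0%N = next_vertex x.
  have := dv 0%N isT; rewrite dist_to_Vertex addr0.
  have := vertex_dist_ge0 (R := R) (next_vertex x) (v 0%N).
  case E : (vertex_dist R (next_vertex x) (v 0%N)) => [w||] //; rewrite lee_fin -EFinD => w0 -[tw].
  by apply/esym/(vertex_dist_eq0 (R := R)); rewrite E; congr EFin; lra.
have vn : v n = prev_vertex y.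
  have := geodesic_dist_diff gP (tP n (leqnn n)) bP (dt n (leqnn n)) dxy.
  rewrite Pt // => /(_ ltac:(lra)).
  rewrite [LHS]dist_from_Vertex -/y.
  have := vertex_dist_ge0 (R := R) (v n) (prev_vertex y).
  case E : (vertex_dist R (v n) (prev_vertex y)) => [w||] //; rewrite lee_fin -EFinD => w0 -[tw].
  by apply: (vertex_dist_eq0 (R := R)); rewrite E; congr EFin; lra.
exists n, v; split.
- split=> // [i j ij|i j m ij].
    by apply/(@vertex_dist_leP R G _ _ _); rewrite dvv.
  by move/(@vertex_dist_leP R G _ _ _); rewrite dvv // lee_fin ler_nat.
- by move=> i ni; exists (t i); [rewrite /= in_itv /= tP|rewrite Pt].
move=> z [s sI <-]; have sP : lo P <= s <= hi P by move: sI; rewrite /= in_itv.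
have := geodesic_finite gP sP; rewrite -/(start P) -/x.
have : (0 <= digraph_semimetric x (P s))%E by exact: digraph_dist_ge0.
case E : (digraph_semimetric x (P s)) => [rho||] // _ _.
have [rle|rgt] := leP rho (to_next x).
  by apply: Or31; rewrite [leLHS]E lee_fin (le_trans rle) // to_next_le1.
have rho_le : rho <= to_next x + n%:R + from_prev y.
  have Ps : image P (P s) by exists s => //=; rewrite in_itv.
  have [_ _] := dist_start_image gP Ps; rewrite dxy [d _ _]E -lee_fin => ->.
  by rewrite leeDl // digraph_dist_ge0.
have dsy := geodesic_dist_diff gP sP bP E dxy rho_le.
have [rge|rlt] := leP (to_next x + n%:R) rho.
  apply: Or32; have fy1 := from_prev_le1 y.
  by rewrite [leLHS]dsy lee_fin; lra.
set k := Num.truncn (rho - to_next x).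
have rx0 : 0 <= rho - to_next x by lra.
have /andP[kr rk] := truncn_itv rx0; rewrite -/k in kr rk.
have kn : (k < n)%N by rewrite -(ltr_nat R); lra.
rewrite -natr1 in rk.
have d1 : d (Vertex R (v k)) (P s) = (rho - (to_next x + k%:R))%:E.
  rewrite -Pt; last exact: ltnW.
  by apply: (geodesic_dist_diff gP (tP k (ltnW kn)) sP (dt k (ltnW kn)) E); lra.
have d2 : d (P s) (Vertex R (v k.+1)) = (to_next x + k.+1%:R - rho)%:E.
  rewrite -Pt //.
  by apply: (geodesic_dist_diff gP sP (tP k.+1 kn) E (dt k.+1 kn)); rewrite -natr1; lra.
apply: Or33; exists k; first exact: kn.
by rewrite d1 d2 !lee_fin -natr1; split; lra.
Qed.

End DigraphCurves.

(** * Change of generators *)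

Local Close Scope ring_scope.

Section Comparison.
Context {V : Type}.
Implicit Types (E F : V -> V -> Prop).

Definition reach_dominated E F L := forall n u v, reach E n u v -> reach F (L * n) u v.

Lemma edge_reach_dominated E F L :
  (forall u v, E u v -> reach F L u v) -> reach_dominated E F L.
Proof.
move=> EF; elim=> [|n IH] u v /=; first by move=> ->; exact: reachxx.
case=> [->|[w uw wv]]; first exact: reachxx.
by rewrite mulnS; apply: reach_cat (EF _ _ uw) (IH _ _ wv).
Qed.

(** The extra first vertex [a] makes room for a corner rounded to a vertex off the curve. *)
Lemma geodesic_seq_quasi E F d K L a b y n v :
  hyperbolic_rel E d K -> reach_dominated E F L -> reach_dominated F E L ->
  reach F 1 a b -> geodesic_seq F b y n v ->
  quasi_geodesic_seq E (L * linear_const d K L + L + 1) n.+1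
    (fun i => if i is j.+1 then v j else a).
Proof.
move=> hypE EF FE ab vg.
set C := linear_const d K L.
have ab' : reach E L a b by rewrite -(muln1 L); exact: FE.
have v0 : v 0 = b by case: vg.
split=> [[|i]|[|i] [|j] k] /= iN; rewrite ?subn0 ?subnn ?sub0n //.
- by rewrite v0; apply: reach_leq ab'; lia.
- have vv := FE _ _ _ (geodesic_seq_reach vg (_ : i <= i.+1 <= n)%N).
  by apply: reach_leq (vv _); rewrite ?subSnn; lia.
(* There need be no path from [b] back to [a], so the triangle inequality does not bound the
   distance from [b] by that from [a]; [linear_bound] does. *)
- move=> av; have [t [T [tk Tg]]] := geodesic_seq_exists av.
  have bv := FE _ _ _ (geodesic_seq_reach vg (_ : 0 <= j <= n)%N).
  have [|w [W [_ Wg]]] := geodesic_seq_exists (bv _); first by lia.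
  rewrite v0 in Wg.
  have wC : (w <= C * t.+1)%N by apply: (linear_bound hypE _ _ Wg); [left; exact: ab'|left; exact: Tg].
  have bvF : reach F (L * w) (v 0) (v j).
    apply: EF; rewrite v0; case: (Wg) => <- <- _ _; rewrite -{1}(subn0 w).
    by apply: geodesic_seq_reach Wg _; lia.
  have := geodesic_seq_leq vg (_ : 0 <= j <= n)%N bvF; rewrite subn0 => /(_ ltac:(lia)) jw.
  by have : (L * w <= L * (C * k.+1))%N; [rewrite leq_mul2l; nia|nia].
- rewrite subSS => vv; have := geodesic_seq_leq vg (_ : i <= j <= n)%N (EF _ _ _ vv).
  by move=> /(_ ltac:(lia)); nia.
Qed.

End Comparison.

(** * Cayley digraphs: degrees and comparison of generating sets *)

Section Cayley.
Context (S : semigroupType).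
Implicit Types (A B : set S).
Local Open Scope group_scope.

Notation cayley_rel A := (@edge_rel (cayley_digraph A)).

Lemma cayley_relP A (u v : S) : cayley_rel A u v <-> exists2 a, A a & u * a = v.
Proof.
split=> [[[w [a aA]] /= <- <-]|[a aA <-]]; first by exists a => //; exact: set_mem.
by exists (u, exist _ a (mem_set aA)).
Qed.

Lemma cayley_bounded_out A : finite_set A -> bounded_degree (cayley_rel A).
Proof.
move=> /finite_seqP[s ->]; exists 'I_(size s) => x.
exists (fun h : 'I_(size s) => x * nth x s h) => y.
move=> /cayley_relP[a /= aS <-]; have := aS; rewrite -index_mem => lt.
by exists (Ordinal lt); rewrite /= nth_index.
Qed.

(** Right cancellation leaves at most one predecessor of [x] for each generator; [xget] picks it,
    with default [x]. *)
Lemma cayley_bounded_in A : right_cancellative S -> finite_set A ->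
  bounded_degree (converse_rel (cayley_rel A)).
Proof.
move=> rc /finite_seqP[s ->]; exists 'I_(size s) => x.
exists (fun h : 'I_(size s) => xget x [set z | z * nth x s h = x]) => y.
move=> /cayley_relP[a /= aS yx]; have := aS; rewrite -index_mem => lt.
exists (Ordinal lt) => /=; rewrite nth_index //.
by apply: xget_unique => //= z zx; apply: (rc a); rewrite zx.
Qed.

(** Uniformity of [n] in [x] makes the elements with this property closed under products. *)
Lemma generating_reach A (s : S) : finite_generating_set A ->
  exists n, forall x, reach (cayley_rel A) n x (x * s).
Proof.
move=> [_ genA]; pose W := [set s | exists n, forall x, reach (cayley_rel A) n x (x * s)].
have : smallest (@subsemigroup S) A s by rewrite genA.
move=> /(_ W); apply; split=> [u v [m um] [n vn]|a Aa].
  exists (m + n)%N => x; rewrite mulgA; exact: reach_cat (um x) (vn _).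
by exists 1%N => x; apply: reach1; apply/cayley_relP; exists a.
Qed.

Lemma cayley_dominated A B : finite_generating_set A -> finite_set B ->
  exists L, reach_dominated (cayley_rel B) (cayley_rel A) L.
Proof.
move=> genA /finite_seqP[s ->].
have [L LP] : exists L, forall b, b \in s -> forall x, reach (cayley_rel A) L x (x * b).
  elim: s => [|b s [L LP]]; first by exists 0%N.
  have [n nP] := generating_reach b genA; exists (n + L)%N => c.
  rewrite inE => /predU1P[->|cs] x; [apply: reach_leq (nP x)|apply: reach_leq (LP c cs x)]; lia.
exists L; apply: edge_reach_dominated => u v /cayley_relP[b bs <-]; exact: LP.
Qed.

End Cayley.

(** * Corners of a geodesic triangle *)

Section Apex.
Context {R : realType} {X : Type} (d : semimetric R X).
Implicit Types P Q T : curve R X.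

Lemma joinsC P x y : joins P x y -> joins P y x.
Proof. by case; [right|left]. Qed.

(* When corners coincide, an end of the side P may be an end of both other sides, so
   the labelling of T and Q does not determine which corner is opposite to P. *)
Lemma joins_apex P Q T x y z : joins P x y -> joins Q z x -> joins T y z ->
  endpoint Q (start P) -> endpoint T (finish P) ->
  exists w, joins Q (start P) w /\ joins T (finish P) w.
Proof.
move=> jP jQ jT eQ eT; exists z; case: jP => -[sP fP].
  by split; [apply: joinsC; rewrite sP|rewrite fP].
suff xy : x = y by rewrite sP fP {1}xy -{2}xy; split; [apply: joinsC; rewrite -xy|rewrite xy].
move: eQ eT; rewrite /endpoint sP fP.
by case: jQ => -[-> ->]; case: jT => -[-> ->]; case=> -> // [] ->.
Qed.

Lemma geodesic_triangle_apex (T : 'I_3 -> curve R X) p q r :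
  geodesic_triangle d T -> uniq [:: p; q; r] ->
  endpoint (T q) (start (T p)) -> endpoint (T r) (finish (T p)) ->
  exists z, joins (T q) (start (T p)) z /\ joins (T r) (finish (T p)) z.
Proof.
move=> [x xT]; have join i : joins (T i) (x i) (x (ordS i)) by have [] := xT i.
have ordSK3 i : ordS (ordS (ordS i)) = i :> 'I_3.
  by apply: val_inj; case: i => -[|[|[|]]].
move=> /= /and3P[]; rewrite !inE negb_or => /andP[pq pr] qr _.
have [[-> ->]|[-> ->]] : (q = ordS p /\ r = ordS (ordS p)) \/ (q = ordS (ordS p) /\ r = ordS p).
  case: p q r pq pr qr => -[|[|[|//]]] ? [[|[|[|//]]] ?] [[|[|[|//]]] ?] // _ _ _;
    by [left; split; exact: val_inj|right; split; exact: val_inj].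
  apply: (@joins_apex _ _ _ (x (ordS p)) (x p) (x (ordS (ordS p)))); first exact: joinsC.
  - exact: joinsC.
  - by apply: joinsC; have := join (ordS (ordS p)); rewrite ordSK3.
apply: (@joins_apex _ _ _ (x p) (x (ordS p)) (x (ordS (ordS p)))) => //.
by have := join (ordS (ordS p)); rewrite ordSK3.
Qed.

End Apex.

(** * Transfer of hyperbolicity between digraphs on the same vertices *)

Section QuasiSides.
Context {R : realType} {G : digraph}.
Notation d := (@digraph_dist R G).
Notation geodesic_curve := (geodesic (@digraph_semimetric R G)).
Local Open Scope ring_scope.

(* Corners are rounded down to [prev_vertex], so that sides with a common corner give
   sequences with a common end; only the first vertex may then lie off the curve. *)
Lemma geodesic_curve_quasi (E : vertex G -> vertex G -> Prop) D K L (P : curve R (point R G)) :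
  hyperbolic_rel E D K -> reach_dominated E (@edge_rel G) L ->
  reach_dominated (@edge_rel G) E L -> geodesic_curve P ->
  exists N c, [/\ quasi_geodesic_seq E (L * linear_const D K L + L + 1) N c,
    c 0%N = prev_vertex (start P), c N = prev_vertex (finish P),
    forall i, (i <= N)%N -> c i = prev_vertex (start P) \/ image P (Vertex R (c i)) &
    forall z, image P z -> [\/ (d (start P) z <= 1)%E, (d z (finish P) <= 1)%E |
      exists2 i, (i < N)%N & [/\ image P (Vertex R (c i)),
        (d (Vertex R (c i)) z <= 1)%E & (d z (Vertex R (c i.+1)) <= 1)%E]]].
Proof.
move=> hypE EF FE gP; have [[pp near]|[n [v [vg vP near]]]] := geodesic_curve_seq gP.
  exists 0%N, (fun=> prev_vertex (start P)); split=> //.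
  - split=> // i j k ij _.
    by have -> : (j - i = 0)%N by lia.
  - by move=> i _; left.
  - by move=> z /near; exact: Or31.
exists n.+1, (fun i => if i is j.+1 then v j else prev_vertex (start P)); split=> //.
- exact: (geodesic_seq_quasi hypE EF FE (reach_prev_next _) vg).
- by case: vg.
- by move=> [|i] iN; [left|right; exact: vP].
move=> z /near[z1|z1|[i ni [iz zi]]]; [exact: Or31|exact: Or32|].
by apply: Or33; exists i.+1 => //; split=> //; apply: vP; exact: ltnW.
Qed.

Lemma dist_Vertex_le (u v : vertex G) n :
  reach (@edge_rel G) n u v -> (d (Vertex R u) (Vertex R v) <= n%:R%:E)%E.
Proof. by move=> uv; rewrite dist_Vertex; apply/vertex_dist_leP. Qed.

Lemma dist_triangle_le (x y z : point R G) (a b : R) :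
  (d x y <= a%:E)%E -> (d y z <= b%:E)%E -> (d x z <= (a + b)%:E)%E.
Proof.
move=> xy yz; apply: le_trans (digraph_dist_triangle x y z) _.
by rewrite EFinD; apply: leeD.
Qed.

Lemma hyperbolic_transfer (E : vertex G -> vertex G -> Prop) D K L :
  hyperbolic_rel E D K -> reach_dominated E (@edge_rel G) L ->
  reach_dominated (@edge_rel G) E L -> hyperbolic_digraph R G.
Proof.
move=> hypE EF FE; set M := (L * linear_const D K L + L + 1)%N.
have [k kP] := @quasi_triangle_thin (vertex G) D K M.
set k' := (L * K (L + k))%N.
exists (L * k + k' + 2)%:R; split=> // T triT p q r pqr eQ eR z Pz.
have gT i : geodesic_curve (T i) by case: triT => x xT; have [] := xT i.
have [w [jQ jR]] := geodesic_triangle_apex triT pqr eQ eR.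
have side i := geodesic_curve_quasi hypE EF FE (gT i).
have [N [c [cq c0 cN _ cnear]]] := side p.
have [Nq [cQ [cQq cQ0 cQN cQP _]]] := side q.
have [Nr [cR [cRq cR0 cRN cRP _]]] := side r.
have start_image i : image (T i) (start (T i)).
  by exists (lo (T i)) => //=; have [/directed_pathP[ab _] _] := gT i; rewrite in_itv /= lexx ab.
have finish_image i : image (T i) (finish (T i)).
  by exists (hi (T i)) => //=; have [/directed_pathP[ab _] _] := gT i; rewrite in_itv /= lexx ab.
have end_image i x : endpoint (T i) x -> image (T i) x by case=> ->.
have [z1|z1|[i iN [Pc cz zc]]] := cnear z Pz.
- left; exists (start (T p)); first exact: end_image.
  by apply: le_trans z1 _; rewrite lee_fin -[leLHS]/(1%:R) ler_nat; lia.
- right; exists (finish (T p)); first exact: end_image.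
  by apply: le_trans z1 _; rewrite lee_fin -[leLHS]/(1%:R) ler_nat; lia.
have jQ' : seq_joins Nq cQ (c 0%N) (prev_vertex w).
  by rewrite /seq_joins cQ0 cQN c0; case: jQ => -[<- <-]; [left|right].
have jR' : seq_joins Nr cR (c N) (prev_vertex w).
  by rewrite /seq_joins cR0 cRN cN; case: jR => -[<- <-]; [left|right].
have [|[j jN ck]|[j jN ck]] :=
    kP E hypE _ _ _ _ _ _ _ _ _ cq cQq cRq erefl erefl jQ' jR' i i.+1 _ (leqnn _).
- by rewrite leqnSn.
- left; have ck' := EF _ _ _ ck.
  have [cQj|Qj] := cQP j jN; last first.
    exists (Vertex R (cQ j)) => //.
    apply: le_trans (dist_triangle_le (dist_Vertex_le ck') cz) _.
    by rewrite lee_fin natr1 ler_nat; lia.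
  (* [cQ j] is the vertex before [start (T q)] and may lie off the side. The start does reach [c i],
     through [start (T p)]; as [next_vertex (start (T q))] and [c i] lie in one out-ball around
     [cQ j], the distance is bounded, which gives [k']. *)
  exists (start (T q)) => //.
  have fin : (d (start (T q)) (Vertex R (c i)) < +oo)%E.
    apply: le_lt_trans (digraph_dist_triangle _ (start (T p)) _) _.
    rewrite lte_add_pinfty //; first by have [] := dist_start_image (gT q) (end_image _ _ eQ).
    by have [] := dist_start_image (gT p) Pc.
  rewrite dist_to_Vertex in fin.
  have [m bm] : exists m, reach (@edge_rel G) m (next_vertex (start (T q))) (c i).
    move: fin; have := vertex_dist_ge0 (R := R) (next_vertex (start (T q))) (c i).
    case E' : (vertex_dist R _ _) => [v||] // _ _.
    by have [m _ bm] := vertex_dist_reach E'; exists m.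
  have bk : reach E (K (L + k)%N) (next_vertex (start (T q))) (c i).
    have [_ outE _] := hypE; apply: outE (FE _ _ _ bm).
      by apply: (@reach_leq _ _ (L * 1)); [lia|exact: FE (reach_prev_next _)].
    by rewrite -cQj; apply: reach_leq ck; lia.
  have : (d (start (T q)) (Vertex R (c i)) <= (1 + k'%:R)%:E)%E.
    rewrite dist_to_Vertex EFinD; apply: leeD; first by rewrite lee_fin to_next_le1.
    by apply/vertex_dist_leP; exact: EF.
  move=> sc; apply: le_trans (dist_triangle_le sc cz) _.
  by rewrite lee_fin !natrD; have := ler0n R (L * k); lra.
right; have ck' := EF _ _ _ ck.
have [cRj|Rj] := cRP j jN; last first.
  exists (Vertex R (cR j)) => //.
  apply: le_trans (dist_triangle_le zc (dist_Vertex_le ck')) _.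
  by rewrite lee_fin nat1r ler_nat; lia.
(* In this direction rounding is harmless: from [cR j] one moves forward along the edge to the
   start. *)
exists (start (T r)) => //.
have : (d (Vertex R (c i.+1)) (start (T r)) <= ((L * k)%:R + 1)%:E)%E.
  rewrite dist_from_Vertex EFinD; apply: leeD; last by rewrite lee_fin from_prev_le1.
  by apply/vertex_dist_leP; rewrite -cRj.
move=> sc; apply: le_trans (dist_triangle_le zc sc) _.
by rewrite lee_fin natr1 nat1r ler_nat; lia.
Qed.

End QuasiSides.

Theorem proposition8p1 (R : realType) (S : semigroupType)
    (fg_S : finitely_generated S) (rc_S : right_cancellative S)
    (hyp_S : hyperbolic_semigroup S R) :
  forall A : set S, finite_generating_set A ->
    hyperbolic_digraph R (cayley_digraph A).
Proof.
move=> A genA; have [B [genB hypB]] := hyp_S.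
have [[finA _] [finB _]] := (genA, genB).
have [D thinB] := hyperbolic_thin_seqs hypB.
have [K hypE] := thin_seqs_hyperbolic thinB
  (cayley_bounded_out finB) (cayley_bounded_in rc_S finB).
have [L1 L1P] := cayley_dominated genA finB.
have [L2 L2P] := cayley_dominated genB finA.
(* Both digraphs have vertex type [S], so the edge relation of [B] is one on the vertices of the
   digraph of [A]. *)
apply: (@hyperbolic_transfer R (cayley_digraph A) (@edge_rel (cayley_digraph B))
  D K (maxn L1 L2) hypE) => n u v uv.
  by apply: reach_leq (L1P _ _ _ uv); rewrite leq_mul2r leq_maxl orbT.
by apply: reach_leq (L2P _ _ _ uv); rewrite leq_mul2r leq_maxr orbT.
Qed.
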